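(* Let $k \geq 1$ be an integer and let $1 < p_1,\dots,p_k,p < \infty$ satisfy $\frac{1}{p} = \frac{1}{p_1} + \dots + \frac{1}{p_k}$. For every $\varepsilon > 0$ there exists $K = K(\varepsilon,k,p_1,\dots,p_k,p)$ such that whenever $R \geq r \geq 1$ are real numbers with $R/r \geq K$, one has $$ \Big\| \sum_{t \in \mathbb{Z}: r \leq |t| \leq R} \frac{f_1(x+t) f_2(x+2t) \cdots f_k(x+kt)}{t} \Big\|_{\ell^p(\mathbb{Z})} \leq \varepsilon \log\frac{R}{r} \prod_{i=1}^k \|f_i\|_{\ell^{p_i}(\mathbb{Z})}$$ for all $f_i \in \ell^{p_i}(\mathbb{Z})$, $i=1,\dots,k$, where the $\ell^p(\mathbb{Z})$ norm on the left is taken in the variable $x \in \mathbb{Z}$. *)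

(* Defs.v *)
From Stdlib Require Import Reals ZArith Lra.
Open Scope R_scope.

Definition Cx := (R * R)%type.
Definition C0 : Cx := (0, 0).
Definition C1 : Cx := (1, 0).
Definition Cadd (a b : Cx) : Cx := (fst a + fst b, snd a + snd b).
Definition Cmul (a b : Cx) : Cx :=
  (fst a * fst b - snd a * snd b, fst a * snd b + snd a * fst b).
Definition Cscale (c : R) (a : Cx) : Cx := (c * fst a, c * snd a).
Definition Cmod (a : Cx) : R := sqrt (fst a ^ 2 + snd a ^ 2).

(* x^a for x >= 0, with the convention 0^a = 0 (Stdlib's Rpower 0 a = 1). *)
Definition rpow (x a : R) : R :=
  if Req_EM_T x 0 then 0 else Rpower x a.

Fixpoint prodR (k : nat) (g : nat -> R) : R :=
  match k with O => 1 | S k' => prodR k' g * g k end.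
Fixpoint sumR (k : nat) (g : nat -> R) : R :=
  match k with O => 0 | S k' => sumR k' g + g k end.
Fixpoint prodC (k : nat) (g : nat -> Cx) : Cx :=
  match k with O => C1 | S k' => Cmul (prodC k' g) (g k) end.

Fixpoint sumC_from (a : Z) (n : nat) (g : Z -> Cx) : Cx :=
  match n with
  | O => C0
  | S n' => Cadd (g a) (sumC_from (a + 1)%Z n' g)
  end.

(* The truncated multilinear Hilbert transform
   x |-> sum_{t in Z, r <= |t| <= Rb} f_1(x+t) ... f_k(x+kt) / t.
   All t with |t| <= Rb lie in [-up Rb, up Rb]. *)
Definition trunc_op (k : nat) (f : nat -> Z -> Cx) (r Rb : R) (x : Z) : Cx :=
  let N := up Rb in
  sumC_from (- N)%Z (Z.to_nat (2 * N + 1)) (fun t =>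
    if Rle_dec r (Rabs (IZR t)) then
      if Rle_dec (Rabs (IZR t)) Rb then
        Cscale (/ IZR t) (prodC k (fun i => f i (x + Z.of_nat i * t)%Z))
      else C0
    else C0).

(* lp_pow_sum p g S  :<->  sum_{x in Z} |g x|^p converges (to S).
   The nonnegative series over Z is enumerated as x = n, -n-1 (n : nat).
   Thus g \in l^p(Z) iff exists S, and ||g||_p = S^(1/p). *)
Definition lp_pow_sum (p : R) (g : Z -> Cx) (S : R) : Prop :=
  infinite_sum
    (fun n : nat => rpow (Cmod (g (Z.of_nat n))) p
                    + rpow (Cmod (g (- Z.of_nat n - 1)%Z)) p) S.

(* Main.v *)
Require Import Defs.
From Stdlib Require Import Reals ZArith List Lra Lia.
Open Scope R_scope.

(** Write the form [sum_x sum_t K(t) f_0(x) f_1(x+t) ... f_k(x+kt)], with [K] the truncated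
    kernel [1/t], as a sum over [J ~ log (R/r)] dyadic kernels [K_j], and let
    [D_j(x) = sum_t K_j(t) f_1(x+t) ... f_k(x+kt)]. For functions bounded by [1], Cauchy-Schwarz
    in [x] removes [f_0] and leaves the energy [sum_{j,j'} <D_j, D_j'>]. When [j] is far below
    [j'], put [t' = t + s]: since [K_j'] varies slowly at scale [2^j], [K_j'(t+s)] may be replaced
    by [K_j'(s)], so [<D_j, D_j'>] is an average over [s] of forms of order [k-1] at scale [j]
    for the functions [f_i(x) f_i(x+is)]. Induction on [k] then gives [o(J)]; the base case is
    [sum_t K_j(t) = 0].

    General exponents follow by cutting each [f_i] according to the size of [|f_i|^{p_i}].
    Restricting all functions to a common band of [m+1] levels and summing over the position of
    the band counts each product [m+1] times, up to the spread of the levels of its factors, and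
    products of large spread are exponentially small. The [l^p] norm is finally recovered by
    duality. *)

(** * Finite sums *)

(** Cauchy-Schwarz costs a square root, but [o(J)] survives it: if each of the [J] scales pairs with
    the earlier ones to give [o(J)], the total energy is [o(J^2)], with root [o(J)]. Pairs of scales
    closer than [m] have no such gain and contribute about [m J], so [m] is chosen before [J]; no
    rate is kept.

    The obstacle to general exponents is that the gain is known only for functions bounded by 1 with
    a common bound [A] on their masses, while a tuple of unrelated levels has factors of very
    different heights and masses. Inside a band of [m + 1] levels, normalising all factors at the
    same level costs only a factor [exp (m + 1)], which the small constant of the bounded case
    absorbs. The products miscounted by the bands see only the trivial bound [O(log (R/r))], but the
    average over [m + 1] bands divides it by [m + 1]. So [m] is fixed first, and the accuracy
    demanded of the bounded case afterwards.

    All sums are finite: functions live on [[-M, M]] and sums run over [[-H, H]] with [H >= 2 M],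
    which leaves room for translations by points of the kernel's support. *)

Definition lsum {A : Type} (l : list A) (g : A -> R) : R :=
  fold_right (fun a s => g a + s) 0 l.

Lemma lsum_ext_in {A} (l : list A) g h :
  (forall a, In a l -> g a = h a) -> lsum l g = lsum l h.
Proof.
  induction l as [|a l IH]; simpl; intros E; [reflexivity|].
  rewrite (E a) by auto. rewrite IH; auto.
Qed.

Lemma lsum_ext {A} (l : list A) g h : (forall a, g a = h a) -> lsum l g = lsum l h.
Proof. intros E; apply lsum_ext_in; auto. Qed.

Lemma lsum_plus {A} (l : list A) g h :
  lsum l (fun a => g a + h a) = lsum l g + lsum l h.
Proof. induction l; simpl; lra. Qed.

Lemma lsum_minus {A} (l : list A) g h :
  lsum l (fun a => g a - h a) = lsum l g - lsum l h.
Proof. induction l; simpl; lra. Qed.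

Lemma lsum_scal {A} (l : list A) c g : lsum l (fun a => c * g a) = c * lsum l g.
Proof. induction l as [|a l IH]; simpl; [ring|]. rewrite IH; ring. Qed.

Lemma lsum_scal_r {A} (l : list A) c g : lsum l (fun a => g a * c) = lsum l g * c.
Proof. induction l as [|a l IH]; simpl; [ring|]. rewrite IH; ring. Qed.

Lemma lsum_zero {A} (l : list A) g : (forall a, In a l -> g a = 0) -> lsum l g = 0.
Proof.
  induction l as [|a l IH]; simpl; intros E; [reflexivity|].
  rewrite (E a), IH by auto; ring.
Qed.

Lemma lsum_const {A} (l : list A) c : lsum l (fun _ => c) = INR (length l) * c.
Proof.
  induction l as [|a l IH]; [simpl; ring|].
  change (lsum (a :: l) (fun _ => c)) with (c + lsum l (fun _ => c)).
  change (length (a :: l)) with (S (length l)). rewrite IH, S_INR; ring.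
Qed.

Lemma lsum_le_in {A} (l : list A) g h :
  (forall a, In a l -> g a <= h a) -> lsum l g <= lsum l h.
Proof.
  induction l as [|a l IH]; simpl; intros E; [lra|].
  apply Rplus_le_compat; auto.
Qed.

Lemma lsum_le {A} (l : list A) g h : (forall a, g a <= h a) -> lsum l g <= lsum l h.
Proof. intros E; apply lsum_le_in; auto. Qed.

Lemma lsum_nonneg {A} (l : list A) g : (forall a, In a l -> 0 <= g a) -> 0 <= lsum l g.
Proof.
  intros E. rewrite <- (lsum_zero l (fun _ => 0)) by auto.
  apply lsum_le_in; auto.
Qed.

Lemma lsum_abs {A} (l : list A) g : Rabs (lsum l g) <= lsum l (fun a => Rabs (g a)).
Proof.
  induction l as [|a l IH]; simpl; [rewrite Rabs_R0; lra|].
  eapply Rle_trans; [apply Rabs_triang|lra].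
Qed.

Lemma lsum_app {A} (l l' : list A) g : lsum (l ++ l') g = lsum l g + lsum l' g.
Proof. induction l; simpl; lra. Qed.

Lemma lsum_swap {A B} (l : list A) (l' : list B) g :
  lsum l (fun a => lsum l' (fun b => g a b)) = lsum l' (fun b => lsum l (fun a => g a b)).
Proof.
  induction l as [|a l IH]; simpl.
  - symmetry; apply lsum_zero; reflexivity.
  - rewrite IH, lsum_plus; reflexivity.
Qed.

Lemma lsum_ge_term {A} (l : list A) g a :
  In a l -> (forall b, In b l -> 0 <= g b) -> g a <= lsum l g.
Proof.
  induction l as [|b l IH]; simpl; intros Ha Hg; [tauto|].
  assert (0 <= lsum l g) by (apply lsum_nonneg; auto).
  destruct Ha as [<-|Ha]; [lra|].
  specialize (IH Ha (fun c Hc => Hg c (or_intror Hc))).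
  specialize (Hg b (or_introl eq_refl)); lra.
Qed.

(** The bound on [g] is asked only where the weight is nonzero because [kf_shift] controls a
    translation by [t] only for [t] in the support of the smaller kernel. *)
Lemma lsum_abs_mult_le {A} (l : list A) w g B C :
  0 <= B -> lsum l (fun a => Rabs (w a)) <= C ->
  (forall a, In a l -> w a <> 0 -> Rabs (g a) <= B) ->
  Rabs (lsum l (fun a => w a * g a)) <= C * B.
Proof.
  intros HB Hw Hg. eapply Rle_trans; [apply lsum_abs|].
  apply Rle_trans with (lsum l (fun a => Rabs (w a) * B)).
  - apply lsum_le_in; intros a Ha. rewrite Rabs_mult.
    destruct (Req_dec (w a) 0) as [E|E].
    + rewrite E, Rabs_R0; lra.
    + apply Rmult_le_compat_l; [apply Rabs_pos|auto].
  - rewrite lsum_scal_r. apply Rmult_le_compat_r; auto.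
Qed.

Lemma lsum_cauchy_schwarz {A} (l : list A) g h :
  (lsum l (fun a => g a * h a)) ^ 2
  <= lsum l (fun a => g a ^ 2) * lsum l (fun a => h a ^ 2).
Proof.
  set (P := lsum l (fun a => g a * h a)).
  set (G := lsum l (fun a => g a ^ 2)). set (H := lsum l (fun a => h a ^ 2)).
  assert (Q : forall u v, 0 <= u ^ 2 * G + 2 * (u * v) * P + v ^ 2 * H).
  { intros u v. unfold G, P, H. rewrite <- !lsum_scal, <- !lsum_plus.
    apply lsum_nonneg; intros a _.
    replace (_ + _ + _) with ((u * g a + v * h a) ^ 2) by ring. apply pow2_ge_0. }
  assert (HG : 0 <= G) by (apply lsum_nonneg; intros; apply pow2_ge_0).
  destruct (Req_dec G 0) as [E|E].
  - destruct (Req_dec P 0) as [EP|EP]; [rewrite E, EP; lra|].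
    (* With [G = 0] the quadratic form is affine in [u]; this [u] gives it the value [-1]. *)
    exfalso. specialize (Q (- (H + 1) / (2 * P)) 1). rewrite E in Q.
    replace (_ ^ 2 * 0 + 2 * (- (H + 1) / (2 * P) * 1) * P + 1 ^ 2 * H) with (-1) in Q
      by (field; auto). lra.
  - specialize (Q (- P) G).
    assert (0 <= G * (G * H - P ^ 2)) by (ring_simplify; ring_simplify in Q; lra).
    assert (0 <= G * H - P ^ 2); [|lra].
    apply Rmult_le_reg_l with G; lra.
Qed.

(** * Sums over intervals of integers *)

Fixpoint zr (a : Z) (n : nat) : list Z :=
  match n with O => nil | S n' => a :: zr (a + 1)%Z n' end.

Definition zsym (H : Z) : list Z := zr (- H) (Z.to_nat (2 * H + 1)).

Definition supp (M : Z) (g : Z -> R) : Prop := forall x, (M < Z.abs x)%Z -> g x = 0.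

Lemma in_zr n : forall a x, In x (zr a n) <-> (a <= x < a + Z.of_nat n)%Z.
Proof.
  induction n as [|n IH]; intros a x; simpl zr; simpl In; [lia|].
  rewrite IH. lia.
Qed.

Lemma in_zsym H x : In x (zsym H) <-> (- H <= x <= H)%Z.
Proof. unfold zsym; rewrite in_zr. lia. Qed.

Lemma zr_app n m : forall a, zr a (n + m) = zr a n ++ zr (a + Z.of_nat n)%Z m.
Proof.
  induction n as [|n IH]; intros a; simpl.
  - f_equal; lia.
  - rewrite IH. do 3 f_equal. lia.
Qed.

Lemma lsum_zr_shift n g c :
  forall a, lsum (zr a n) (fun x => g (x + c)%Z) = lsum (zr (a + c)%Z n) g.
Proof.
  induction n as [|n IH]; intros a; simpl; [reflexivity|].
  rewrite IH. do 3 f_equal. lia.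
Qed.

Lemma lsum_zr_supp M g a n :
  supp M g -> (0 <= M)%Z -> (a <= - M)%Z -> (M < a + Z.of_nat n)%Z ->
  lsum (zr a n) g = lsum (zsym M) g.
Proof.
  intros Hs HM Ha Hn.
  replace n with (Z.to_nat (- M - a) + (Z.to_nat (2 * M + 1) + (n - Z.to_nat (M + 1 - a))))%nat
    by lia.
  rewrite !zr_app, !lsum_app.
  replace (a + Z.of_nat (Z.to_nat (- M - a)))%Z with (- M)%Z by lia.
  rewrite (lsum_zero (zr a _)), (lsum_zero (zr (_ + _)%Z _)).
  - fold (zsym M). ring.
  - intros x Hx. apply in_zr in Hx. apply Hs. lia.
  - intros x Hx. apply in_zr in Hx. apply Hs. lia.
Qed.

Lemma lsum_zsym_supp M H g :
  supp M g -> (0 <= M <= H)%Z -> lsum (zsym H) g = lsum (zsym M) g.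
Proof. intros. unfold zsym at 1. apply lsum_zr_supp; auto; lia. Qed.

(** Both the support and its translate fit into [[-H, H]], so nothing crosses the ends. With
    [|c| <= M] this is where [H >= 2 M] enters. *)
Lemma lsum_zsym_shift M H g c :
  supp M g -> (0 <= M)%Z -> (M + Z.abs c <= H)%Z ->
  lsum (zsym H) (fun x => g (x + c)%Z) = lsum (zsym H) g.
Proof.
  intros Hs HM Hc. unfold zsym at 1. rewrite lsum_zr_shift.
  rewrite (lsum_zr_supp M), (lsum_zsym_supp M H); auto; lia.
Qed.

Lemma lsum_zsym_subset H H' g :
  (forall x, 0 <= g x) -> (0 <= H <= H')%Z -> lsum (zsym H) g <= lsum (zsym H') g.
Proof.
  intros Hg HH. unfold zsym.
  replace (Z.to_nat (2 * H' + 1))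
    with (Z.to_nat (H' - H) + (Z.to_nat (2 * H + 1) + Z.to_nat (H' - H)))%nat by lia.
  rewrite !zr_app, !lsum_app.
  replace (- H' + Z.of_nat (Z.to_nat (H' - H)))%Z with (- H)%Z by lia.
  pose proof (lsum_nonneg (zr (- H') (Z.to_nat (H' - H))) g (fun x _ => Hg x)).
  pose proof (lsum_nonneg (zr (- H + Z.of_nat (Z.to_nat (2 * H + 1))) (Z.to_nat (H' - H))) g
                (fun x _ => Hg x)).
  lra.
Qed.

(** For nonnegative functions a translation can only push mass out of the interval, so no room is
    required; this serves the shifts by [i * t], which may be larger than [H]. *)
Lemma lsum_zsym_shift_le M H g c :
  supp M g -> (forall x, 0 <= g x) -> (0 <= M <= H)%Z ->
  lsum (zsym H) (fun x => g (x + c)%Z) <= lsum (zsym H) g.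
Proof.
  intros Hs Hg HM.
  apply Rle_trans with (lsum (zsym (H + Z.abs c)) (fun x => g (x + c)%Z)).
  - apply lsum_zsym_subset with (g := fun x => g (x + c)%Z); [auto|lia].
  - rewrite (lsum_zsym_shift M); auto; try lia.
    rewrite (lsum_zsym_supp M (H + Z.abs c)), (lsum_zsym_supp M H); auto; try lia. lra.
Qed.

Lemma lsum_zr_opp n g :
  forall a, lsum (zr a n) (fun x => g (- x)%Z) = lsum (zr (1 - a - Z.of_nat n)%Z n) g.
Proof.
  induction n as [|n IH]; intros a; [reflexivity|].
  replace (S n) with (n + 1)%nat at 1 by lia. rewrite zr_app, lsum_app, IH.
  replace (1 - a - Z.of_nat (S n))%Z with (- (a + Z.of_nat n))%Z by lia.
  cbn [zr lsum fold_right].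
  replace (- (a + Z.of_nat n) + 1)%Z with (1 - a - Z.of_nat n)%Z by lia.
  unfold lsum. lra.
Qed.

Lemma lsum_zsym_opp H g : lsum (zsym H) (fun x => g (- x)%Z) = lsum (zsym H) g.
Proof.
  destruct (Z_le_gt_dec 0 H) as [HH|HH].
  - unfold zsym. rewrite lsum_zr_opp. do 2 f_equal. lia.
  - unfold zsym. replace (Z.to_nat (2 * H + 1)) with O by lia. reflexivity.
Qed.

Lemma lsum_zr_telescope n V :
  forall a, lsum (zr a n) (fun s => V (s + 1)%Z - V s) = V (a + Z.of_nat n)%Z - V a.
Proof.
  induction n as [|n IH]; intros a.
  - simpl. replace (a + 0)%Z with a by lia. ring.
  - simpl zr. simpl lsum. rewrite IH.
    replace (a + 1 + Z.of_nat n)%Z with (a + Z.of_nat (S n))%Z by lia. ring.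
Qed.

Lemma lsum_zsym_telescope H V :
  (0 <= H)%Z -> lsum (zsym H) (fun s => V (s + 1)%Z - V s) = V (H + 1)%Z - V (- H)%Z.
Proof.
  intros HH. unfold zsym. rewrite lsum_zr_telescope. do 2 f_equal. lia.
Qed.

(** A translation by [c] is [|c|] unit steps, and the increments of each step telescope to a
    difference of two values of [V], at most [B]. *)
Lemma lsum_zsym_increments H V B c :
  (0 <= H)%Z -> (forall s, 0 <= V s <= B) -> (forall s u, (s <= u)%Z -> V s <= V u) ->
  lsum (zsym H) (fun s => Rabs (V (s + c)%Z - V s)) <= IZR (Z.abs c) * B.
Proof.
  intros HH HV Hmon.
  (* The offset [d] serves negative [c]: there the increment runs upwards from [s + c] to [s]. *)
  assert (P : forall n d, lsum (zsym H) (fun s => V (s + d + Z.of_nat n)%Z - V (s + d)%Z)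
                          <= INR n * B).
  { induction n as [|n IH]; intros d.
    - rewrite lsum_zero; [simpl; lra|]. intros s _.
      replace (s + d + Z.of_nat 0)%Z with (s + d)%Z by lia. ring.
    - rewrite S_INR.
      pose proof (lsum_zsym_telescope H (fun y => V (y + (d + Z.of_nat n))%Z) HH) as T.
      cbv beta in T.
      rewrite (lsum_ext _ _ (fun s => (V (s + d + Z.of_nat n)%Z - V (s + d)%Z)
         + (V (s + 1 + (d + Z.of_nat n))%Z - V (s + (d + Z.of_nat n))%Z))).
      + rewrite lsum_plus, T. specialize (IH d).
        pose proof (HV (H + 1 + (d + Z.of_nat n))%Z).
        pose proof (HV (- H + (d + Z.of_nat n))%Z). lra.
      + intros s.
        replace (s + d + Z.of_nat (S n))%Z with (s + 1 + (d + Z.of_nat n))%Z by lia.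
        replace (s + (d + Z.of_nat n))%Z with (s + d + Z.of_nat n)%Z by lia. ring. }
  destruct (Z_le_gt_dec 0 c) as [Hc|Hc].
  - specialize (P (Z.to_nat c) 0%Z).
    rewrite INR_IZR_INZ, Z2Nat.id in P by lia. rewrite Z.abs_eq by lia.
    eapply Rle_trans; [|exact P]. apply lsum_le; intros s.
    replace (s + 0)%Z with s by lia. rewrite Rabs_pos_eq; [lra|].
    pose proof (Hmon s (s + c)%Z ltac:(lia)). lra.
  - specialize (P (Z.to_nat (- c)) c).
    rewrite INR_IZR_INZ, Z2Nat.id in P by lia. rewrite Z.abs_neq by lia.
    eapply Rle_trans; [|exact P]. apply lsum_le; intros s.
    replace (s + c + - c)%Z with s by lia.
    pose proof (Hmon (s + c)%Z s ltac:(lia)).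
    rewrite Rabs_minus_sym, Rabs_pos_eq; lra.
Qed.

(** * Multilinear forms on bounded functions *)

(** Indexed from 0 and unfolding at the first factor, so that [f 0], evaluated at [x] itself, splits
    off by computation and the remaining factors are reindexed by [S]. *)
Fixpoint pr (n : nat) (F : nat -> R) : R :=
  match n with O => 1 | S n' => F O * pr n' (fun i => F (S i)) end.

Lemma pr_ext n : forall F G, (forall i, (i < n)%nat -> F i = G i) -> pr n F = pr n G.
Proof.
  induction n as [|n IH]; intros F G E; simpl; [reflexivity|].
  rewrite (E O) by lia. f_equal. apply IH. intros i Hi. apply E. lia.
Qed.

Lemma pr_mult n : forall F G, pr n (fun i => F i * G i) = pr n F * pr n G.
Proof.
  induction n as [|n IH]; intros F G; simpl; [ring|].
  rewrite (IH (fun i => F (S i)) (fun i => G (S i))). ring.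
Qed.

Lemma pr_abs n : forall F, Rabs (pr n F) = pr n (fun i => Rabs (F i)).
Proof.
  induction n as [|n IH]; intros F; simpl; [apply Rabs_R1|].
  rewrite Rabs_mult, IH; reflexivity.
Qed.

Lemma pr_abs_le1 n : forall F, (forall i, Rabs (F i) <= 1) -> Rabs (pr n F) <= 1.
Proof.
  induction n as [|n IH]; intros F E; simpl; [rewrite Rabs_R1; lra|].
  rewrite Rabs_mult. rewrite <- (Rmult_1_r 1).
  apply Rmult_le_compat; auto using Rabs_pos.
Qed.

Definition form (H : Z) (n : nat) (w : Z -> R) (f : nat -> Z -> R) : R :=
  lsum (zsym H) (fun x => lsum (zsym H) (fun t =>
    w t * pr n (fun i => f i (x + Z.of_nat i * t)%Z))).

Definition dual (H : Z) (n : nat) (w : Z -> R) (f : nat -> Z -> R) (x : Z) : R :=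
  lsum (zsym H) (fun t => w t * pr n (fun i => f (S i) (x + Z.of_nat (S i) * t)%Z)).

(** The index drops by one because of the substitution [x = y - t], which turns [x + (i + 1) t] into
    [y + i t]. The new function of index 0 is then free of [t] and can be removed in its turn. *)
Definition differenced (f : nat -> Z -> R) (s : Z) (i : nat) (y : Z) : R :=
  f (S i) y * f (S i) (y + Z.of_nat (S i) * s)%Z.

(* [kf_shift]: kernels at least [m] scales above that of [t] hardly feel a translation by [t]. *)
Record kernel_family (M H : Z) (m : nat) (C delta : R) (K : nat -> Z -> R) : Prop := {
  kf_M : (0 <= M)%Z;
  kf_H : (2 * M <= H)%Z;
  kf_C : 0 <= C;
  kf_delta : 0 <= delta;
  kf_supp : forall j, supp M (K j);
  kf_mean : forall j, lsum (zsym H) (K j) = 0;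
  kf_norm : forall j, lsum (zsym H) (fun t => Rabs (K j t)) <= C;
  kf_shift : forall j j' t, (j + m <= j')%nat -> K j t <> 0 ->
    lsum (zsym H) (fun s => Rabs (K j' (s + t)%Z - K j' s)) <= delta }.

Arguments kf_M {M H m C delta K} _.
Arguments kf_H {M H m C delta K} _.
Arguments kf_C {M H m C delta K} _.
Arguments kf_delta {M H m C delta K} _.
Arguments kf_supp {M H m C delta K} _.
Arguments kf_mean {M H m C delta K} _.
Arguments kf_norm {M H m C delta K} _.
Arguments kf_shift {M H m C delta K} _.

(** A bound proportional to [A] is the natural one: as [|f i| <= 1], the norm of [f i] in
    [l^(1/q i)] is at most [A^(q i)], and the [q i] will sum to 1. Differencing keeps the same [A],
    since it multiplies by a function bounded by 1; this lets the induction run. *)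
Record bounded_family (M H : Z) (A : R) (f : nat -> Z -> R) : Prop := {
  bf_supp : forall i, supp M (f i);
  bf_le1 : forall i x, Rabs (f i x) <= 1;
  bf_sum : forall i, lsum (zsym H) (fun x => Rabs (f i x)) <= A }.

Arguments bf_supp {M H A f} _.
Arguments bf_le1 {M H A f} _.
Arguments bf_sum {M H A f} _.

Lemma bounded_family_nonneg M H A f : bounded_family M H A f -> 0 <= A.
Proof.
  intros Hf. eapply Rle_trans; [|apply (bf_sum Hf O)].
  apply lsum_nonneg; intros; apply Rabs_pos.
Qed.

Lemma differenced_bounded M H A f s :
  bounded_family M H A f -> bounded_family M H A (differenced f s).
Proof.
  intros Hf.
  assert (P : forall i x, Rabs (differenced f s i x) <= Rabs (f (S i) x)).
  { intros i x. unfold differenced. rewrite Rabs_mult.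
    rewrite <- (Rmult_1_r (Rabs (f (S i) x))) at 2.
    apply Rmult_le_compat_l; [apply Rabs_pos|apply (bf_le1 Hf)]. }
  split.
  - intros i x Hx. unfold differenced. rewrite (bf_supp Hf (S i) x Hx). ring.
  - intros i x. eapply Rle_trans; [apply P|apply (bf_le1 Hf)].
  - intros i. eapply Rle_trans; [|apply (bf_sum Hf (S i))].
    apply lsum_le; auto.
Qed.

Lemma form_dual H n w f :
  form H (S n) w f = lsum (zsym H) (fun x => f O x * dual H n w f x).
Proof.
  unfold form, dual. apply lsum_ext; intros x. rewrite <- lsum_scal.
  apply lsum_ext; intros t. cbn [pr].
  replace (x + Z.of_nat 0 * t)%Z with x by lia. ring.
Qed.

Lemma pr_differenced n f x s t :
  pr n (fun i => f (S i) (x + Z.of_nat (S i) * t)%Z)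
  * pr n (fun i => f (S i) (x + Z.of_nat (S i) * (s + t))%Z)
  = pr n (fun i => differenced f s i (x + t + Z.of_nat i * t)%Z).
Proof.
  rewrite <- pr_mult. apply pr_ext; intros i _. unfold differenced.
  f_equal; f_equal; lia.
Qed.

Definition correlation (H : Z) (n : nat) (f : nat -> Z -> R) (s t : Z) : R :=
  lsum (zsym H) (fun y => pr n (fun i => differenced f s i (y + Z.of_nat i * t)%Z)).

(** Only the factor of index 0 is summed; the others are bounded by 1. *)
Lemma correlation_bound M H n A f s t :
  bounded_family M H A f -> Rabs (correlation H (S n) f s t) <= A.
Proof.
  intros Hf. pose proof (differenced_bounded _ _ _ _ s Hf) as Hg.
  unfold correlation. eapply Rle_trans; [apply lsum_abs|].
  eapply Rle_trans; [|apply (bf_sum Hg O)].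
  apply lsum_le; intros y. cbn [pr]. rewrite Rabs_mult.
  replace (y + Z.of_nat 0 * t)%Z with y by lia.
  rewrite <- (Rmult_1_r (Rabs (differenced f s 0 y))) at 2.
  apply Rmult_le_compat_l; [apply Rabs_pos|].
  apply pr_abs_le1. intros i. apply (bf_le1 Hg).
Qed.

(* Substitute [t' = s + t] in the second kernel and [x = y - t]. *)
Lemma dual_inner M H n A f u v :
  (0 <= M)%Z -> (2 * M <= H)%Z -> supp M u -> supp M v -> bounded_family M H A f ->
  lsum (zsym H) (fun x => dual H (S n) u f x * dual H (S n) v f x)
  = lsum (zsym H) (fun t => u t * lsum (zsym H) (fun s =>
      v (s + t)%Z * correlation H (S n) f s t)).
Proof.
  intros HM HH Hu Hv Hf.
  set (P := fun x t => pr (S n) (fun i => f (S i) (x + Z.of_nat (S i) * t)%Z)).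
  transitivity (lsum (zsym H) (fun x => lsum (zsym H) (fun t => lsum (zsym H) (fun s =>
      u t * (v (s + t)%Z * (P x t * P x (s + t)%Z)))))).
  - apply lsum_ext; intros x.
    change (lsum (zsym H) (fun t => u t * P x t) * lsum (zsym H) (fun t => v t * P x t)
            = lsum (zsym H) (fun t => lsum (zsym H) (fun s =>
                u t * (v (s + t)%Z * (P x t * P x (s + t)%Z))))).
    rewrite <- lsum_scal_r. apply lsum_ext; intros t.
    destruct (Z_le_gt_dec (Z.abs t) M) as [Ht|Ht].
    + rewrite <- (lsum_zsym_shift M H (fun t' => v t' * P x t') t); try lia.
      * rewrite <- lsum_scal. apply lsum_ext; intros s. unfold P. ring.
      * intros y Hy. rewrite Hv by auto. ring.
    + rewrite (Hu t) by lia. transitivity 0; [ring|symmetry; apply lsum_zero; intros; ring].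
  - rewrite lsum_swap. apply lsum_ext; intros t.
    destruct (Z_le_gt_dec (Z.abs t) M) as [Ht|Ht].
    + rewrite lsum_swap. rewrite <- lsum_scal. apply lsum_ext; intros s.
      rewrite !lsum_scal. do 2 f_equal. unfold correlation.
      set (Q := fun y => pr (S n) (fun i => differenced f s i (y + Z.of_nat i * t)%Z)).
      rewrite <- (lsum_zsym_shift M H Q t); try lia.
      * apply lsum_ext; intros x. apply pr_differenced.
      * intros y Hy. unfold Q. cbn [pr].
        replace (y + Z.of_nat 0 * t)%Z with y by lia.
        rewrite (bf_supp (differenced_bounded _ _ _ _ s Hf) O y Hy). ring.
    + rewrite (Hu t) by lia.
      rewrite lsum_zero; [ring|]. intros x _. apply lsum_zero; intros; ring.
Qed.

(** The trivial bound, without cancellation, for pairs of scales less than [m] apart and for the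
    diagonal. *)
Lemma dual_inner_bound M H m C delta K n A f j j' :
  kernel_family M H m C delta K -> bounded_family M H A f ->
  Rabs (lsum (zsym H) (fun x => dual H (S n) (K j) f x * dual H (S n) (K j') f x))
  <= C * (C * A).
Proof.
  intros HK Hf.
  pose proof (kf_M HK) as HM. pose proof (kf_H HK) as HH.
  pose proof (kf_C HK) as HC. pose proof (bounded_family_nonneg _ _ _ _ Hf) as HA.
  rewrite (dual_inner M H n A); auto; try apply (kf_supp HK).
  apply lsum_abs_mult_le.
  - apply Rmult_le_pos; auto.
  - apply (kf_norm HK).
  - intros t _ Ht. apply lsum_abs_mult_le; auto.
    + rewrite (lsum_zsym_shift M H (fun y => Rabs (K j' y)) t).
      * apply (kf_norm HK).
      * intros y Hy. rewrite (kf_supp HK j' y Hy). apply Rabs_R0.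
      * lia.
      * destruct (Z_le_gt_dec (Z.abs t) M); [lia|].
        exfalso. apply Ht. apply (kf_supp HK). lia.
    + intros s _ _. eapply correlation_bound; eauto.
Qed.

(* For well separated scales the inner product is an average over [s] of forms with one function less. *)
Lemma dual_inner_separated M H m C delta K n A f j j' :
  kernel_family M H m C delta K -> bounded_family M H A f -> (j + m <= j')%nat ->
  Rabs (lsum (zsym H) (fun x => dual H (S n) (K j) f x * dual H (S n) (K j') f x)
        - lsum (zsym H) (fun s => K j' s * form H (S n) (K j) (differenced f s)))
  <= C * (delta * A).
Proof.
  intros HK Hf Hj.
  pose proof (kf_M HK) as HM. pose proof (kf_H HK) as HH.
  pose proof (kf_C HK) as HC. pose proof (bounded_family_nonneg _ _ _ _ Hf) as HA.
  pose proof (kf_delta HK) as Hd.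
  rewrite (dual_inner M H n A); auto; try apply (kf_supp HK).
  assert (E : lsum (zsym H) (fun s => K j' s * form H (S n) (K j) (differenced f s))
    = lsum (zsym H) (fun t => K j t * lsum (zsym H) (fun s =>
        K j' s * correlation H (S n) f s t))).
  { transitivity (lsum (zsym H) (fun s => lsum (zsym H) (fun t =>
      K j t * (K j' s * correlation H (S n) f s t)))).
    - apply lsum_ext; intros s. unfold form. rewrite lsum_swap, <- lsum_scal.
      apply lsum_ext; intros t. unfold correlation. rewrite lsum_scal. ring.
    - rewrite lsum_swap. apply lsum_ext; intros t. rewrite lsum_scal. reflexivity. }
  rewrite E, <- lsum_minus.
  rewrite (lsum_ext _ _ (fun t => K j t * lsum (zsym H) (fun s =>
      (K j' (s + t)%Z - K j' s) * correlation H (S n) f s t))).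
  - apply lsum_abs_mult_le.
    + apply Rmult_le_pos; auto.
    + apply (kf_norm HK).
    + intros t _ Ht. apply lsum_abs_mult_le; auto.
      * eapply (kf_shift HK); eauto.
      * intros s _ _. eapply correlation_bound; eauto.
  - intros t. rewrite <- Rmult_minus_distr_l, <- lsum_minus. f_equal.
    apply lsum_ext; intros s. ring.
Qed.

(** Under the root is an energy bound: for each of [J] scales, twice the main term from one function
    less, twice the [J] errors of replacing [K_j'(s + t)] by [K_j'(s)], and [2 m + 1] trivially
    bounded pairs ([m] close ones counted twice, and the diagonal). *)
Fixpoint growth (C delta : R) (m J n : nat) : R :=
  match n with
  | O => 0
  | S n' => sqrt (INR J * (2 * (C * growth C delta m J n') + 2 * (INR J * (C * delta))
                           + (2 * INR m + 1) * (C * C)))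
  end.

Lemma growth_nonneg C delta m J n : 0 <= growth C delta m J n.
Proof. destruct n; simpl; [lra|apply sqrt_pos]. Qed.

Lemma seq_split_last n : seq 0 (S n) = seq 0 n ++ (n :: nil).
Proof. rewrite seq_S. reflexivity. Qed.

(* Cauchy-Schwarz removes [f 0]; the energy of [sum_{j < N} dual (K j)] is then estimated one
   scale at a time. *)
Lemma form_sum_bound M H m C delta K :
  kernel_family M H m C delta K ->
  forall J n A f N, bounded_family M H A f -> (N <= J)%nat ->
  Rabs (lsum (seq 0 N) (fun j => form H (S n) (K j) f)) <= growth C delta m J n * A.
Proof.
  intros HK.
  pose proof (kf_C HK) as HC. pose proof (kf_delta HK) as Hd.
  intros J. induction n as [|n IH]; intros A f N Hf HN;
    pose proof (bounded_family_nonneg _ _ _ _ Hf) as HA.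
  - rewrite lsum_zero; [rewrite Rabs_R0; simpl; lra|].
    intros j _. unfold form. apply lsum_zero; intros x _.
    rewrite (lsum_ext _ _ (fun t => K j t * f O x)).
    + rewrite lsum_scal_r, (kf_mean HK). ring.
    + intros t. cbn [pr]. replace (x + Z.of_nat 0 * t)%Z with x by lia. ring.
  - set (D := fun j x => dual H (S n) (K j) f x).
    set (G := growth C delta m J n) in *.
    set (b := 2 * (C * G) + 2 * (INR J * (C * delta)) + (2 * INR m + 1) * (C * C)).
    assert (HG : 0 <= G) by apply growth_nonneg.
    assert (Hb : 0 <= b).
    { unfold b. pose proof (pos_INR J). pose proof (pos_INR m).
      repeat apply Rplus_le_le_0_compat; repeat apply Rmult_le_pos; try lra. }
    assert (Cross : forall q, (q < J)%nat ->
      Rabs (lsum (zsym H) (fun x => lsum (seq 0 q) (fun j => D j x) * D q x))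
      <= (C * G + INR J * (C * delta) + INR m * (C * C)) * A).
    { intros q Hq.
      set (I := fun j => lsum (zsym H) (fun x => D j x * D q x)).
      assert (E : lsum (zsym H) (fun x => lsum (seq 0 q) (fun j => D j x) * D q x)
                  = lsum (seq 0 q) I).
      { unfold I. rewrite lsum_swap. apply lsum_ext; intros x. rewrite <- lsum_scal_r.
        reflexivity. }
      rewrite E. clear E.
      (* Scales below [k] are at least [m] below [q]; at most [m] others remain. The subtraction
         truncates, so [k = 0] when [q < m]. *)
      set (k := (q - m)%nat).
      replace q with (k + (q - k))%nat at 1 by lia. rewrite seq_app, lsum_app.
      set (Mn := fun j => lsum (zsym H) (fun s => K q s * form H (S n) (K j) (differenced f s))).
      assert (E1 : Rabs (lsum (seq 0 k) (fun j => I j - Mn j)) <= INR J * (C * delta) * A).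
      { eapply Rle_trans; [apply lsum_abs|].
        apply Rle_trans with (lsum (seq 0 k) (fun _ => C * (delta * A))).
        - apply lsum_le_in; intros j Hj. apply in_seq in Hj.
          eapply dual_inner_separated; eauto. lia.
        - rewrite lsum_const, length_seq.
          replace (INR J * (C * delta) * A) with (INR J * (C * (delta * A))) by ring.
          apply Rmult_le_compat_r; [repeat apply Rmult_le_pos; auto|].
          apply le_INR; lia. }
      (* The weight [K q s] does not depend on [j], so at fixed [s] the whole sum over [j < k] can
         be given to the induction hypothesis. It is a partial sum of scales, which is why the
         statement allows every [N <= J]. *)
      assert (E2 : Rabs (lsum (seq 0 k) Mn) <= C * G * A).
      { unfold Mn. rewrite lsum_swap.
        rewrite (lsum_ext _ _ (fun s => K q s *
           lsum (seq 0 k) (fun j => form H (S n) (K j) (differenced f s))))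
          by (intros s; apply lsum_scal).
        rewrite Rmult_assoc. apply lsum_abs_mult_le.
        - apply Rmult_le_pos; auto.
        - apply (kf_norm HK).
        - intros s _ _. apply IH; [apply differenced_bounded; auto|lia]. }
      assert (E3 : Rabs (lsum (seq (0 + k) (q - k)) I) <= INR m * (C * C) * A).
      { eapply Rle_trans; [apply lsum_abs|].
        apply Rle_trans with (lsum (seq (0 + k) (q - k)) (fun _ => C * (C * A))).
        - apply lsum_le_in; intros j Hj. eapply dual_inner_bound; eauto.
        - rewrite lsum_const, length_seq.
          replace (INR m * (C * C) * A) with (INR m * (C * (C * A))) by ring.
          apply Rmult_le_compat_r; [repeat apply Rmult_le_pos; auto|].
          apply le_INR; lia. }
      rewrite lsum_minus in E1.
      revert E1 E2 E3. unfold Rabs. repeat destruct Rcase_abs; lra. }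
    assert (Energy : forall q, (q <= J)%nat ->
      lsum (zsym H) (fun x => lsum (seq 0 q) (fun j => D j x) ^ 2) <= INR q * (b * A)).
    { induction q as [|q IHq]; intros Hq.
      - rewrite lsum_zero; [simpl; lra|]. intros x _. simpl. ring.
      - specialize (IHq ltac:(lia)). specialize (Cross q ltac:(lia)).
        pose proof (dual_inner_bound M H m C delta K n A f q q HK Hf) as Diag.
        rewrite (lsum_ext _ _ (fun x => lsum (seq 0 q) (fun j => D j x) ^ 2
          + (2 * (lsum (seq 0 q) (fun j => D j x) * D q x) + D q x * D q x))).
        + rewrite !lsum_plus, lsum_scal, S_INR. fold (D q) in Diag.
          apply Rle_trans with (INR q * (b * A)
            + (2 * ((C * G + INR J * (C * delta) + INR m * (C * C)) * A) + C * (C * A))).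
          * apply Rplus_le_compat; [exact IHq|]. apply Rplus_le_compat.
            -- apply Rmult_le_compat_l; [lra|].
               eapply Rle_trans; [apply Rle_abs|exact Cross].
            -- eapply Rle_trans; [apply Rle_abs|exact Diag].
          * unfold b. lra.
        + intros x. rewrite seq_split_last, lsum_app.
          change (lsum (q :: nil) (fun j => D j x)) with (D q x + 0). ring. }
    specialize (Energy N HN).
    rewrite (lsum_ext _ _ (fun j => lsum (zsym H) (fun x => f O x * D j x)))
      by (intros j; apply form_dual).
    rewrite lsum_swap.
    rewrite (lsum_ext _ _ (fun x => f O x * lsum (seq 0 N) (fun j => D j x)))
      by (intros x; apply lsum_scal).
    pose proof (lsum_cauchy_schwarz (zsym H) (f O) (fun x => lsum (seq 0 N) (fun j => D j x))) as CS.
    cbv beta in CS.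
    (* [|f 0| <= 1] makes the square at most the absolute value, so the [l^2] norm squared is
       controlled by [A]. *)
    assert (F0 : lsum (zsym H) (fun x => f O x ^ 2) <= A).
    { eapply Rle_trans; [|apply (bf_sum Hf O)]. apply lsum_le; intros x.
      rewrite <- pow2_abs. pose proof (bf_le1 Hf O x). pose proof (Rabs_pos (f O x)). nra. }
    assert (F0' : 0 <= lsum (zsym H) (fun x => f O x ^ 2))
      by (apply lsum_nonneg; intros; apply pow2_ge_0).
    assert (Hs : 0 <= lsum (zsym H) (fun x => lsum (seq 0 N) (fun j => D j x) ^ 2))
      by (apply lsum_nonneg; intros; apply pow2_ge_0).
    set (T := lsum (zsym H) (fun x => f O x * lsum (seq 0 N) (fun j => D j x))) in *.
    assert (HT : T ^ 2 <= INR J * b * A ^ 2).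
    { eapply Rle_trans; [exact CS|].
      replace (INR J * b * A ^ 2) with (A * (INR J * (b * A))) by ring.
      apply Rmult_le_compat; auto. eapply Rle_trans; [exact Energy|].
      apply Rmult_le_compat_r; [apply Rmult_le_pos; auto|apply le_INR; auto]. }
    change (growth C delta m J (S n)) with (sqrt (INR J * b)).
    assert (HJb : 0 <= INR J * b) by (apply Rmult_le_pos; [apply pos_INR|auto]).
    apply Rsqr_incr_0_var.
    + unfold Rsqr. rewrite <- Rabs_mult, Rabs_pos_eq by nra.
      replace (sqrt (INR J * b) * A * (sqrt (INR J * b) * A))
        with ((sqrt (INR J * b) * sqrt (INR J * b)) * A ^ 2) by ring.
      rewrite sqrt_sqrt by auto. lra.
    + apply Rmult_le_pos; [apply sqrt_pos|auto].
Qed.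

(** * Dyadic decomposition of the kernel *)

Lemma exists_INR_ge x : exists N : nat, x <= INR N.
Proof.
  exists (Z.to_nat (up x)). destruct (archimed x) as [H _].
  rewrite INR_IZR_INZ.
  assert (IZR (up x) <= IZR (Z.of_nat (Z.to_nat (up x)))) by (apply IZR_le; lia). lra.
Qed.

Lemma INR_le_pow2 m : INR m <= 2 ^ m.
Proof.
  induction m as [|m IH]; [simpl; lra|]. rewrite S_INR. simpl pow.
  assert (1 <= 2 ^ m) by (apply pow_R1_Rle; lra). lra.
Qed.

(** Stated for all [m] beyond [m0], not for one [m], because every level of the recursion uses the
    same [m]. *)
Lemma growth_small n : forall eps, 0 < eps ->
  exists m0, forall m, (m0 <= m)%nat -> exists J0, forall J, (J0 <= J)%nat ->
  growth 4 (12 / 2 ^ m) m J n <= eps * INR J.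
Proof.
  induction n as [|n IH]; intros eps He.
  - exists O; intros m _. exists O; intros J _. simpl.
    pose proof (pos_INR J). apply Rmult_le_pos; lra.
  - assert (He2 : 0 < eps ^ 2) by (apply pow_lt; auto).
    (* The constants make each of the three terms under the root at most [eps^2 / 3 * J]:
       [8 * eps^2 / 24] for the first, [96 / 2^m] with [2^m >= 288 / eps^2] for the second, and
       [16 (2 m + 1)] with [J >= 48 (2 m + 1) / eps^2] for the third. *)
    destruct (IH (eps ^ 2 / 24) ltac:(lra)) as [m1 H1].
    destruct (exists_INR_ge (288 / eps ^ 2)) as [m2 H2].
    exists (m1 + m2)%nat; intros m Hm.
    destruct (H1 m ltac:(lia)) as [J1 HJ1].
    destruct (exists_INR_ge ((2 * INR m + 1) * 48 / eps ^ 2)) as [J2 H3].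
    exists (J1 + J2)%nat; intros J HJ. specialize (HJ1 J ltac:(lia)).
    set (g := growth 4 (12 / 2 ^ m) m J n) in *. cbn [growth]. fold g.
    pose proof (pos_INR J) as HJp.
    assert (P2 : 0 < 2 ^ m) by (apply pow_lt; lra).
    assert (Hdel : 2 * (4 * (12 / 2 ^ m)) <= eps ^ 2 / 3).
    { assert (Q : 288 / eps ^ 2 <= 2 ^ m).
      { eapply Rle_trans; [exact H2|]. eapply Rle_trans; [|apply INR_le_pow2].
        apply le_INR; lia. }
      apply (Rmult_le_compat_r (eps ^ 2 / (3 * 2 ^ m))) in Q.
      - replace (288 / eps ^ 2 * (eps ^ 2 / (3 * 2 ^ m))) with (2 * (4 * (12 / 2 ^ m))) in Q
          by (field; lra).
        replace (2 ^ m * (eps ^ 2 / (3 * 2 ^ m))) with (eps ^ 2 / 3) in Q by (field; lra).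
        exact Q.
      - apply Rlt_le, Rdiv_lt_0_compat; lra. }
    assert (Hm3 : (2 * INR m + 1) * (4 * 4) <= eps ^ 2 / 3 * INR J).
    { assert (Q : (2 * INR m + 1) * 48 / eps ^ 2 <= INR J)
        by (eapply Rle_trans; [exact H3|apply le_INR; lia]).
      apply (Rmult_le_compat_r (eps ^ 2 / 3)) in Q; [|lra].
      replace ((2 * INR m + 1) * 48 / eps ^ 2 * (eps ^ 2 / 3))
        with ((2 * INR m + 1) * (4 * 4)) in Q by (field; lra). lra. }
    apply Rle_trans with (sqrt ((eps * INR J) ^ 2)).
    + apply sqrt_le_1_alt.
      replace ((eps * INR J) ^ 2) with (INR J * (eps ^ 2 * INR J)) by ring.
      apply Rmult_le_compat_l; auto.
      assert (2 * (INR J * (4 * (12 / 2 ^ m))) <= INR J * (eps ^ 2 / 3)).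
      { replace (2 * (INR J * (4 * (12 / 2 ^ m)))) with (INR J * (2 * (4 * (12 / 2 ^ m)))) by ring.
        apply Rmult_le_compat_l; auto. }
      lra.
    + rewrite sqrt_pow2; [lra|]. apply Rmult_le_pos; lra.
Qed.

Definition window (a Rb s : R) : R :=
  if Rle_dec a s then if Rlt_dec s (2 * a) then if Rle_dec s Rb then / s else 0 else 0 else 0.

(** A variation function for [window]: the jump [1/a] at [a], then the decrease [1/a - 1/s]. Past
    the window the value [3/a] exceeds the whole variation, at most [2/a]. Being nondecreasing, it
    turns the [l^1] size of a shift difference into a telescoping sum. *)
Definition window_variation (a Rb s : R) : R :=
  if Rle_dec a s then
    if Rlt_dec s (2 * a) then if Rle_dec s Rb then 2 / a - / s else 3 / a else 3 / a
  else 0.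

Ltac window_cases :=
  repeat match goal with
  | |- context [Rle_dec ?x ?y] => destruct (Rle_dec x y)
  | |- context [Rlt_dec ?x ?y] => destruct (Rlt_dec x y)
  end.

Lemma inv_le_bounds a s : 1 <= a -> a <= s -> 0 < / s <= / a.
Proof.
  intros. split; [apply Rinv_0_lt_compat; lra|apply Rinv_le_contravar; lra].
Qed.

Lemma window_variation_bounds a Rb s : 1 <= a -> 0 <= window_variation a Rb s <= 3 / a.
Proof.
  intros Ha. pose proof (inv_le_bounds a a Ha ltac:(lra)).
  unfold window_variation, Rdiv. window_cases; try (pose proof (inv_le_bounds a s Ha ltac:(lra))); lra.
Qed.

Lemma window_increment a Rb s u :
  1 <= a -> s <= u ->
  Rabs (window a Rb u - window a Rb s) <= window_variation a Rb u - window_variation a Rb s.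
Proof.
  intros Ha Hsu. pose proof (inv_le_bounds a a Ha ltac:(lra)).
  unfold window, window_variation, Rdiv.
  window_cases; try lra;
    try (pose proof (inv_le_bounds a s Ha ltac:(lra)));
    try (pose proof (inv_le_bounds a u Ha ltac:(lra)));
    try (pose proof (Rinv_le_contravar s u ltac:(lra) ltac:(lra)));
    unfold Rabs; destruct Rcase_abs; lra.
Qed.

Lemma window_variation_mono a Rb s u :
  1 <= a -> s <= u -> window_variation a Rb s <= window_variation a Rb u.
Proof.
  intros Ha Hsu. pose proof (window_increment a Rb s u Ha Hsu).
  pose proof (Rabs_pos (window a Rb u - window a Rb s)). lra.
Qed.

Lemma window_nonneg a Rb s : 1 <= a -> 0 <= window a Rb s.
Proof.
  intros Ha. unfold window.
  window_cases; try (pose proof (inv_le_bounds a s Ha ltac:(lra))); lra.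
Qed.

Lemma window_sum a Rb H :
  1 <= a -> (0 <= H)%Z -> lsum (zsym H) (fun s => window a Rb (IZR s)) <= 2.
Proof.
  intros Ha HH.
  (* The clamp of [s] to [[a, 2 a + 1]] grows by exactly 1 from each integer [s] in [[a, 2 a)], so
     it counts the window. Its total growth is at most [a + 1 <= 2 a]. *)
  set (Phi := fun s : Z => Rmax a (Rmin (IZR s) (2 * a + 1))).
  assert (Hmon : forall s, 0 <= Phi (s + 1)%Z - Phi s).
  { intros s. apply Rge_le, Rge_minus, Rle_ge, Rle_max_compat_l, Rle_min_compat_r, IZR_le. lia. }
  apply Rle_trans with (lsum (zsym H) (fun s => / a * (Phi (s + 1)%Z - Phi s))).
  - apply lsum_le; intros s. pose proof (inv_le_bounds a a Ha ltac:(lra)) as Hi.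
    unfold window. destruct (Rle_dec a (IZR s)); [destruct (Rlt_dec (IZR s) (2 * a));
      [destruct (Rle_dec (IZR s) Rb)|]|]; try (apply Rmult_le_pos; [lra|apply Hmon]).
    unfold Phi. rewrite plus_IZR, !Rmin_left, !Rmax_right by lra.
    pose proof (inv_le_bounds a (IZR s) Ha ltac:(lra)). lra.
  - rewrite lsum_scal, lsum_zsym_telescope by auto.
    assert (Phi (H + 1)%Z - Phi (- H)%Z <= 2 * a).
    { unfold Phi. pose proof (Rmax_l a (Rmin (IZR (- H)) (2 * a + 1))).
      pose proof (Rmax_lub a (Rmin (IZR (H + 1)) (2 * a + 1)) (2 * a + 1) ltac:(lra) (Rmin_r _ _)).
      lra. }
    replace 2 with (/ a * (2 * a)) by (field; lra).
    apply Rmult_le_compat_l; [|auto].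
    apply Rlt_le, Rinv_0_lt_compat; lra.
Qed.

(** Built as an odd function, which makes its mean zero. *)
Definition dyadic_kernel (r Rb : R) (j : nat) (t : Z) : R :=
  window (2 ^ j * r) Rb (IZR t) - window (2 ^ j * r) Rb (IZR (- t)).

Definition hilbert_kernel (r Rb : R) (t : Z) : R :=
  if Rle_dec r (Rabs (IZR t)) then
    if Rle_dec (Rabs (IZR t)) Rb then / IZR t else 0
  else 0.

Lemma dyadic_scale_ge1 r j : 1 <= r -> 1 <= 2 ^ j * r.
Proof.
  intros Hr. assert (1 <= 2 ^ j) by (apply pow_R1_Rle; lra). nra.
Qed.

Lemma dyadic_kernel_norm r Rb j H :
  1 <= r -> (0 <= H)%Z -> lsum (zsym H) (fun t => Rabs (dyadic_kernel r Rb j t)) <= 4.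
Proof.
  intros Hr HH. pose proof (dyadic_scale_ge1 r j Hr) as Ha.
  apply Rle_trans with (lsum (zsym H) (fun t => window (2 ^ j * r) Rb (IZR t)
                                     + window (2 ^ j * r) Rb (IZR (- t)))).
  - apply lsum_le; intros t. unfold dyadic_kernel.
    pose proof (window_nonneg _ Rb (IZR t) Ha). pose proof (window_nonneg _ Rb (IZR (- t)) Ha).
    unfold Rabs; destruct Rcase_abs; lra.
  - rewrite lsum_plus, (lsum_zsym_opp H (fun t => window (2 ^ j * r) Rb (IZR t))).
    pose proof (window_sum _ Rb H Ha HH). lra.
Qed.

Lemma dyadic_kernel_shift r Rb j H c :
  1 <= r -> (0 <= H)%Z ->
  lsum (zsym H) (fun s => Rabs (dyadic_kernel r Rb j (s + c)%Z - dyadic_kernel r Rb j s))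
  <= 6 * IZR (Z.abs c) / (2 ^ j * r).
Proof.
  intros Hr HH. pose proof (dyadic_scale_ge1 r j Hr) as Ha. unfold dyadic_kernel.
  set (a := 2 ^ j * r) in *.
  set (V := fun s : Z => window_variation a Rb (IZR s)).
  assert (P : forall s u : Z, Rabs (window a Rb (IZR u) - window a Rb (IZR s)) <= Rabs (V u - V s)).
  { intros s u. destruct (Z_le_gt_dec s u) as [L|L].
    - eapply Rle_trans; [apply window_increment; auto; apply IZR_le; lia|apply Rle_abs].
    - rewrite (Rabs_minus_sym (window _ _ _)), (Rabs_minus_sym (V u)).
      eapply Rle_trans; [apply window_increment; auto; apply IZR_le; lia|apply Rle_abs]. }
  assert (Q : forall d, lsum (zsym H) (fun s => Rabs (V (s + d)%Z - V s)) <= IZR (Z.abs d) * (3 / a)).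
  { intros d. apply lsum_zsym_increments; auto.
    - intros s. apply window_variation_bounds; auto.
    - intros s u L. apply window_variation_mono; auto. apply IZR_le; auto. }
  apply Rle_trans with (lsum (zsym H) (fun s => Rabs (V (s + c)%Z - V s)
       + (fun y => Rabs (V (y + - c)%Z - V y)) (- s)%Z)).
  - apply lsum_le; intros s. cbv beta.
    replace (- s + - c)%Z with (- (s + c))%Z by lia.
    pose proof (P s (s + c)%Z). pose proof (P (- s)%Z (- (s + c))%Z).
    replace (window a Rb (IZR (s + c)) - window a Rb (IZR (- (s + c)))
             - (window a Rb (IZR s) - window a Rb (IZR (- s))))
      with ((window a Rb (IZR (s + c)) - window a Rb (IZR s))
            - (window a Rb (IZR (- (s + c))) - window a Rb (IZR (- s)))) by ring.
    eapply Rle_trans; [apply Rabs_triang|]. rewrite Rabs_Ropp. lra.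
  - rewrite lsum_plus, (lsum_zsym_opp H (fun y => Rabs (V (y + - c)%Z - V y))).
    pose proof (Q c). pose proof (Q (- c)%Z) as Q2. rewrite Z.abs_opp in Q2.
    unfold Rdiv in *. lra.
Qed.

Lemma dyadic_kernel_family r Rb M H m :
  1 <= r -> (0 <= M)%Z -> Rb <= IZR M -> (2 * M <= H)%Z ->
  kernel_family M H m 4 (12 / 2 ^ m) (dyadic_kernel r Rb).
Proof.
  intros Hr HM HRb HH.
  assert (P2 : 0 < 2 ^ m) by (apply pow_lt; lra).
  split; auto.
  - lra.
  - apply Rlt_le, Rdiv_lt_0_compat; lra.
  - intros j x Hx. pose proof (dyadic_scale_ge1 r j Hr).
    unfold dyadic_kernel, window. rewrite opp_IZR.
    assert (IZR x > Rb \/ IZR x < - Rb).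
    { destruct (Z_lt_ge_dec M x) as [L|L].
      - left. apply IZR_lt in L. lra.
      - right. assert (x < - M)%Z as L' by lia. apply IZR_lt in L'. rewrite opp_IZR in L'. lra. }
    window_cases; lra.
  - intros j. unfold dyadic_kernel. rewrite lsum_minus.
    rewrite (lsum_zsym_opp H (fun t => window (2 ^ j * r) Rb (IZR t))). ring.
  - intros j. apply dyadic_kernel_norm; auto. lia.
  - intros j j' t Hj Ht. eapply Rle_trans; [apply dyadic_kernel_shift; auto; lia|].
    pose proof (dyadic_scale_ge1 r j Hr) as Ha. pose proof (dyadic_scale_ge1 r j' Hr) as Ha'.
    (* The kernel at scale [j] lives on [|t| <= 2 * 2^j r], so the shift bound [6 |t| / (2^j' r)] is
       at most [12 * 2^j / 2^j'], hence at most [12 / 2^m]. *)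
    assert (L : IZR (Z.abs t) <= 2 * (2 ^ j * r)).
    { rewrite abs_IZR. revert Ht. unfold dyadic_kernel, window. rewrite opp_IZR.
      unfold Rabs. destruct Rcase_abs; window_cases; intros; lra. }
    replace (12 / 2 ^ m) with (6 * (2 * (2 ^ j * r)) / (2 ^ (j + m) * r)).
    + apply Rle_trans with (6 * (2 * (2 ^ j * r)) / (2 ^ j' * r)).
      * unfold Rdiv. apply Rmult_le_compat_r; [|lra].
        apply Rlt_le, Rinv_0_lt_compat; lra.
      * unfold Rdiv. apply Rmult_le_compat_l; [lra|].
        apply Rinv_le_contravar.
        -- pose proof (dyadic_scale_ge1 r (j + m) Hr). lra.
        -- apply Rmult_le_compat_r; [lra|]. apply Rle_pow; [lra|lia].
    + rewrite pow_add. field. repeat split; try lra. apply pow_nonzero; lra.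
Qed.

(** The half-open windows [[2^j r, 2^(j+1) r)] tile [[r, 2^J r)] without overlap. *)
Lemma window_dyadic_sum r Rb s J :
  1 <= r -> lsum (seq 0 J) (fun j => window (2 ^ j * r) Rb s)
  = if Rle_dec r s then if Rlt_dec s (2 ^ J * r) then if Rle_dec s Rb then / s else 0 else 0 else 0.
Proof.
  intros Hr. induction J as [|J IH].
  - simpl. window_cases; lra.
  - rewrite seq_split_last, lsum_app, IH.
    change (lsum (J :: nil) (fun j => window (2 ^ j * r) Rb s)) with (window (2 ^ J * r) Rb s + 0).
    unfold window. simpl pow. pose proof (dyadic_scale_ge1 r J Hr).
    assert (r <= 2 ^ J * r) by (assert (1 <= 2 ^ J) by (apply pow_R1_Rle; lra); nra).
    window_cases; lra.
Qed.

Lemma hilbert_kernel_dyadic r Rb J t :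
  1 <= r -> Rb < 2 ^ J * r ->
  hilbert_kernel r Rb t = lsum (seq 0 J) (fun j => dyadic_kernel r Rb j t).
Proof.
  intros Hr HJ. unfold dyadic_kernel. rewrite lsum_minus, !window_dyadic_sum by auto.
  rewrite opp_IZR. unfold hilbert_kernel.
  destruct (Rle_dec 0 (IZR t)) as [Ht|Ht].
  - rewrite Rabs_pos_eq by auto. window_cases; lra.
  - rewrite Rabs_left by lra.
    assert (E : / - IZR t = - / IZR t) by (field; lra).
    window_cases; try rewrite E; lra.
Qed.

Lemma ln_le_compat x y : 0 < x -> x <= y -> ln x <= ln y.
Proof.
  intros Hx [L|<-]; [apply Rlt_le, ln_increasing; auto|lra].
Qed.

(* [J] is about [log_2 (Rb / r)], and [1 / ln 2 < 2]. *)
Lemma dyadic_scale_count r Rb J0 :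
  1 <= r -> r <= Rb -> exp (INR J0 + 1) <= Rb / r ->
  exists J, (J0 <= J)%nat /\ Rb < 2 ^ J * r /\ INR J <= 3 * ln (Rb / r).
Proof.
  intros Hr HR HJ0.
  set (l := ln (Rb / r)).
  (* In particular [l >= 1], which absorbs the rounding: [J <= l / ln 2 + 1 <= 2 l + 1 <= 3 l]. *)
  assert (Hl : INR J0 + 1 <= l).
  { unfold l. rewrite <- (ln_exp (INR J0 + 1)). apply ln_le_compat; [apply exp_pos|auto]. }
  pose proof (pos_INR J0) as HJp.
  pose proof ln_lt_2 as L2.
  assert (L2' : ln 2 < 1).
  { rewrite <- (ln_exp 1). apply ln_increasing; [lra|]. pose proof (exp_ineq1 1 ltac:(lra)); lra. }
  assert (Hq : l <= l / ln 2 <= 2 * l).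
  { split; apply Rmult_le_reg_r with (ln 2); try lra; unfold Rdiv; rewrite Rmult_assoc, Rinv_l by lra; nra. }
  destruct (archimed (l / ln 2)) as [U1 U2].
  set (z := up (l / ln 2)) in *.
  assert (Hz : (0 <= z)%Z) by (apply le_IZR; lra).
  assert (Ez : INR (Z.to_nat z) = IZR z) by (rewrite INR_IZR_INZ, Z2Nat.id; auto).
  exists (Z.to_nat z). repeat split.
  - apply INR_le. lra.
  - assert (E : Rb / r < 2 ^ Z.to_nat z).
    { rewrite <- Rpower_pow by lra. unfold Rpower. rewrite Ez.
      rewrite <- (exp_ln (Rb / r)) by (apply Rdiv_lt_0_compat; lra). fold l.
      apply exp_increasing.
      apply Rmult_lt_compat_r with (r := ln 2) in U1; [|lra].
      unfold Rdiv in U1. rewrite Rmult_assoc, Rinv_l in U1 by lra. lra. }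
    apply Rmult_lt_compat_r with (r := r) in E; [|lra].
    unfold Rdiv in E. rewrite Rmult_assoc, Rinv_l in E by lra. lra.
  - lra.
Qed.

Lemma hilbert_kernel_norm r Rb H :
  1 <= r -> r <= Rb -> exp 1 <= Rb / r -> (0 <= H)%Z ->
  lsum (zsym H) (fun t => Rabs (hilbert_kernel r Rb t)) <= 12 * ln (Rb / r).
Proof.
  intros Hr HR He HH.
  destruct (dyadic_scale_count r Rb 0 Hr HR) as [J [_ [HJ HJl]]].
  { simpl INR. rewrite Rplus_0_l. auto. }
  apply Rle_trans with (lsum (zsym H) (fun t => lsum (seq 0 J) (fun j =>
                          Rabs (dyadic_kernel r Rb j t)))).
  - apply lsum_le; intros t. rewrite (hilbert_kernel_dyadic r Rb J) by auto. apply lsum_abs.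
  - rewrite lsum_swap. apply Rle_trans with (lsum (seq 0 J) (fun _ => 4)).
    + apply lsum_le; intros j. apply dyadic_kernel_norm; auto.
    + rewrite lsum_const, length_seq. lra.
Qed.

Lemma hilbert_form_bounded n eps :
  0 < eps -> exists K, forall r Rb, 1 <= r -> r <= Rb -> K <= Rb / r ->
  forall M H A f, (0 <= M)%Z -> Rb <= IZR M -> (2 * M <= H)%Z -> bounded_family M H A f ->
  Rabs (form H (S n) (hilbert_kernel r Rb) f) <= eps * ln (Rb / r) * A.
Proof.
  intros He. destruct (growth_small n (eps / 3) ltac:(lra)) as [m Hm].
  destruct (Hm m (Nat.le_refl m)) as [J0 HJ0].
  exists (exp (INR J0 + 1)). intros r Rb Hr HR HK M H A f HM HRM HH Hf.
  destruct (dyadic_scale_count r Rb J0 Hr HR HK) as [J [HJ [HJr HJl]]].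
  specialize (HJ0 J HJ).
  assert (E : form H (S n) (hilbert_kernel r Rb) f
              = lsum (seq 0 J) (fun j => form H (S n) (dyadic_kernel r Rb j) f)).
  { unfold form. rewrite (lsum_swap (seq 0 J)). apply lsum_ext; intros x.
    rewrite lsum_swap. apply lsum_ext; intros t.
    rewrite lsum_scal_r, <- (hilbert_kernel_dyadic r Rb J) by auto. reflexivity. }
  rewrite E.
  eapply Rle_trans.
  { apply (form_sum_bound M H m 4 (12 / 2 ^ m) (dyadic_kernel r Rb)) with (J := J) (A := A);
      auto using dyadic_kernel_family. }
  apply Rmult_le_compat_r; [eapply bounded_family_nonneg; eauto|].
  eapply Rle_trans; [exact HJ0|].
  apply Rle_trans with (eps / 3 * (3 * ln (Rb / r))); [|lra].
  apply Rmult_le_compat_l; lra.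
Qed.

(** * Interpolation *)

Lemma lsum_map {A B} (h : A -> B) (l : list A) g : lsum (map h l) g = lsum l (fun a => g (h a)).
Proof. induction l as [|a l IH]; simpl; [reflexivity|]. rewrite IH; reflexivity. Qed.

Lemma pr_exp n : forall F, pr n (fun i => exp (F i)) = exp (lsum (seq 0 n) F).
Proof.
  induction n as [|n IH]; intros F; simpl; [symmetry; apply exp_0|].
  rewrite (IH (fun i => F (S i))), <- seq_shift, lsum_map, exp_plus. reflexivity.
Qed.

Lemma pr_zero n : forall F i, (i < n)%nat -> F i = 0 -> pr n F = 0.
Proof.
  induction n as [|n IH]; intros F i Hi E; [lia|]. simpl. destruct i as [|i].
  - rewrite E; ring.
  - rewrite (IH (fun i => F (S i)) i); auto; [ring|lia].
Qed.

Lemma pr_one n : forall F, (forall i, (i < n)%nat -> F i = 1) -> pr n F = 1.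
Proof.
  induction n as [|n IH]; intros F E; simpl; [reflexivity|].
  rewrite (E O), IH by (intros; try apply E; lia). ring.
Qed.

Lemma pr_le n : forall F G, (forall i, (i < n)%nat -> 0 <= F i <= G i) -> 0 <= pr n F <= pr n G.
Proof.
  induction n as [|n IH]; intros F G E; simpl; [lra|].
  destruct (E O ltac:(lia)).
  destruct (IH (fun i => F (S i)) (fun i => G (S i))) as [I1 I2]; [intros; apply E; lia|].
  split; [apply Rmult_le_pos; auto|apply Rmult_le_compat; auto].
Qed.

Lemma exists_argmax n (v : nat -> Z) :
  exists i, (i < S n)%nat /\ forall j, (j < S n)%nat -> (v j <= v i)%Z.
Proof.
  induction n as [|n [i [Hi E]]].
  - exists O; split; [lia|]. intros j Hj. replace j with O by lia. lia.
  - destruct (Z_le_gt_dec (v i) (v (S n))) as [L|L].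
    + exists (S n); split; [lia|]. intros j Hj.
      destruct (Nat.eq_dec j (S n)) as [->|]; [lia|]. specialize (E j ltac:(lia)); lia.
    + exists i; split; [lia|]. intros j Hj.
      destruct (Nat.eq_dec j (S n)) as [->|]; [lia|]. apply E; lia.
Qed.

Lemma exists_lower_bound n (q : nat -> R) :
  (forall i, (i < n)%nat -> 0 < q i) -> exists c, 0 < c /\ forall i, (i < n)%nat -> c <= q i.
Proof.
  induction n as [|n IH]; intros Hq.
  - exists 1; split; [lra|lia].
  - destruct IH as [c [Hc E]]; [intros; apply Hq; lia|].
    exists (Rmin c (q n)); split.
    + apply Rmin_pos; auto.
    + intros i Hi. destruct (Nat.eq_dec i n) as [->|]; [apply Rmin_r|].
      eapply Rle_trans; [apply Rmin_l|]. apply E; lia.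
Qed.

Lemma exists_Zabs_bound {A} (l : list A) (g : A -> Z) :
  exists B, (0 <= B)%Z /\ forall a, In a l -> (Z.abs (g a) <= B)%Z.
Proof.
  induction l as [|b l [B [HB E]]].
  - exists 0%Z; simpl; split; [lia|tauto].
  - exists (B + Z.abs (g b))%Z; split; [lia|]. intros a [<-|Ha]; [lia|].
    specialize (E a Ha); lia.
Qed.

(** Indicator that the level [v] lies in the band [[l - m, l]] with top [l]. It is written as a
    condition on [l] because the bands will be summed over [l]. *)
Definition band (m : nat) (l v : Z) : R :=
  if (Z.leb v l && Z.leb l (v + Z.of_nat m))%bool then 1 else 0.

Lemma band_cases m l v :
  (band m l v = 1 /\ (v <= l <= v + Z.of_nat m)%Z)
  \/ (band m l v = 0 /\ ~ (v <= l <= v + Z.of_nat m)%Z).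
Proof.
  unfold band. destruct (Z.leb_spec v l); destruct (Z.leb_spec l (v + Z.of_nat m)); simpl;
    [left|right|right|right]; split; auto; lia.
Qed.

Lemma interval_indicator_sum H a c g :
  (0 <= H)%Z -> (a <= c + 1)%Z ->
  (forall l, (a <= l <= c)%Z -> g l = 1) -> (forall l, ~ (a <= l <= c)%Z -> g l = 0) ->
  lsum (zsym H) g <= IZR (c + 1 - a) /\
  ((- H <= a)%Z -> (c <= H)%Z -> lsum (zsym H) g = IZR (c + 1 - a)).
Proof.
  intros HH Hac H1 H0.
  (* The increments of this clamp are the indicator of [[a, c]]. *)
  set (V := fun l => IZR (Z.max a (Z.min l (c + 1)))).
  assert (E : lsum (zsym H) g = V (H + 1)%Z - V (- H)%Z).
  { rewrite <- lsum_zsym_telescope by auto. apply lsum_ext; intros l. unfold V.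
    rewrite <- minus_IZR.
    destruct (Z_le_gt_dec a l); [destruct (Z_le_gt_dec l c)|].
    - rewrite H1 by lia. f_equal. lia.
    - rewrite H0 by lia. f_equal. lia.
    - rewrite H0 by lia. f_equal. lia. }
  rewrite E. unfold V. rewrite <- minus_IZR. split.
  - apply IZR_le. lia.
  - intros. f_equal. lia.
Qed.

Lemma band_sum m H v : (0 <= H)%Z -> lsum (zsym H) (fun l => band m l v) <= INR m + 1.
Proof.
  intros HH.
  destruct (interval_indicator_sum H v (v + Z.of_nat m) (fun l => band m l v)) as [E _]; auto.
  - lia.
  - intros l Hl. destruct (band_cases m l v) as [[]|[]]; [auto|tauto].
  - intros l Hl. destruct (band_cases m l v) as [[]|[]]; [tauto|auto].
  - rewrite INR_IZR_INZ, <- plus_IZR. eapply Rle_trans; [exact E|]. apply IZR_le. lia.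
Qed.

(** The bands containing all the levels are those with [v i1 <= l <= v i0 + m]: they number [m + 1]
    minus the spread. If the spread exceeds [m + 1] there are none, and then [m + 1] itself is below
    the spread. *)
Lemma band_product_count n m H v i0 i1 :
  (i0 < S n)%nat -> (i1 < S n)%nat ->
  (forall i, (i < S n)%nat -> (v i0 <= v i <= v i1)%Z) ->
  (forall i, (i < S n)%nat -> (Z.abs (v i) + Z.of_nat m <= H)%Z) ->
  Rabs (INR m + 1 - lsum (zsym H) (fun l => pr (S n) (fun i => band m l (v i))))
  <= IZR (v i1 - v i0).
Proof.
  intros Hi0 Hi1 Hv HH.
  pose proof (HH i0 Hi0). pose proof (HH i1 Hi1). pose proof (Hv i1 Hi1).
  assert (P1 : forall l, (v i1 <= l <= v i0 + Z.of_nat m)%Z ->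
            pr (S n) (fun i => band m l (v i)) = 1).
  { intros l Hl. apply pr_one. intros i Hi. specialize (Hv i Hi).
    destruct (band_cases m l (v i)) as [[]|[]]; [auto|lia]. }
  assert (P0 : forall l, ~ (v i1 <= l <= v i0 + Z.of_nat m)%Z ->
            pr (S n) (fun i => band m l (v i)) = 0).
  { intros l Hl. destruct (Z_le_gt_dec (v i1) l).
    - apply pr_zero with i0; auto. destruct (band_cases m l (v i0)) as [[]|[]]; [lia|auto].
    - apply pr_zero with i1; auto. destruct (band_cases m l (v i1)) as [[]|[]]; [lia|auto]. }
  rewrite INR_IZR_INZ.
  destruct (Z_le_gt_dec (v i1) (v i0 + Z.of_nat m + 1)) as [L|L].
  - destruct (interval_indicator_sum H _ _ _ ltac:(lia) L P1 P0) as [_ E].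
    rewrite E by lia. rewrite <- plus_IZR, <- minus_IZR, <- abs_IZR. apply IZR_le. lia.
  - rewrite lsum_zero.
    + rewrite Rminus_0_r, <- plus_IZR, <- abs_IZR. apply IZR_le. lia.
    + intros l _. apply P0. lia.
Qed.

Lemma mult_exp_neg_le c u : 0 < c -> 0 <= u -> u * exp (- (c * u)) <= / c.
Proof.
  intros Hc Hu. rewrite exp_Ropp.
  assert (1 + c * u <= exp (c * u)).
  { destruct Hu as [Hu|<-].
    - apply Rlt_le, exp_ineq1. pose proof (Rmult_lt_0_compat _ _ Hc Hu). lra.
    - rewrite Rmult_0_r, exp_0. lra. }
  assert (0 <= c * u) by (apply Rmult_le_pos; lra).
  apply Rmult_le_reg_r with (exp (c * u)); [lra|].
  rewrite Rmult_assoc, Rinv_l by lra.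
  apply Rmult_le_reg_l with c; [lra|].
  rewrite <- (Rmult_assoc c (/ c)), Rinv_r by lra. lra.
Qed.

(* A product whose factors sit at levels [v i] of spread [d] is smaller by [exp (- c d)] than the
   top level, which pays for a factor [d]. *)
Lemma product_spread_bound n q c (v : nat -> Z) i0 i1 :
  0 < c -> (forall i, (i < S n)%nat -> c <= q i) -> lsum (seq 0 (S n)) q = 1 ->
  (i0 < S n)%nat -> (i1 < S n)%nat ->
  (forall i, (i < S n)%nat -> (v i0 <= v i <= v i1)%Z) ->
  pr (S n) (fun i => exp (q i * (IZR (v i) + 1))) * IZR (v i1 - v i0)
  <= exp 1 / c * exp (IZR (v i1)).
Proof.
  intros Hc Hq Hsum Hi0 Hi1 Hv. rewrite pr_exp.
  set (d := IZR (v i1 - v i0)).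
  assert (Hd : 0 <= d) by (apply IZR_le; specialize (Hv i1 Hi1); lia).
  assert (L : lsum (seq 0 (S n)) (fun i => q i * (IZR (v i) + 1)) <= IZR (v i1) + 1 - c * d).
  { assert (E : lsum (seq 0 (S n)) (fun i => q i * (IZR (v i) + 1))
      = IZR (v i1) + 1 - lsum (seq 0 (S n)) (fun i => q i * (IZR (v i1) - IZR (v i)))).
    { rewrite (lsum_ext _ _ (fun i => q i * (IZR (v i1) + 1) - q i * (IZR (v i1) - IZR (v i))))
        by (intros; ring).
      rewrite lsum_minus, lsum_scal_r, Hsum. ring. }
    rewrite E. apply Rplus_le_compat_l, Ropp_le_contravar.
    (* All deficits from the top level are nonnegative; the one of the lowest factor alone gives
       [c d]. *)
    apply Rle_trans with (q i0 * (IZR (v i1) - IZR (v i0))).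
    - unfold d in *. rewrite minus_IZR in *. apply Rmult_le_compat_r; auto.
    - apply (lsum_ge_term (seq 0 (S n)) (fun i => q i * (IZR (v i1) - IZR (v i))) i0).
      + apply in_seq; lia.
      + intros i Hi. apply in_seq in Hi. specialize (Hq i ltac:(lia)).
        destruct (Hv i ltac:(lia)) as [_ L]. apply IZR_le in L.
        apply Rmult_le_pos; lra. }
  apply Rle_trans with (exp (IZR (v i1) + 1 - c * d) * d).
  - apply Rmult_le_compat_r; auto.
    destruct L as [L|L]; [apply Rlt_le, exp_increasing; auto|rewrite L; lra].
  - replace (IZR (v i1) + 1 - c * d) with (1 + IZR (v i1) + - (c * d)) by ring.
    rewrite !exp_plus. pose proof (mult_exp_neg_le c d Hc Hd) as E.
    pose proof (exp_pos 1). pose proof (exp_pos (IZR (v i1))).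
    replace (exp 1 / c * exp (IZR (v i1))) with (exp 1 * exp (IZR (v i1)) * / c) by (unfold Rdiv; ring).
    rewrite !Rmult_assoc. apply Rmult_le_compat_l; [lra|].
    apply Rmult_le_compat_l; [lra|]. lra.
Qed.

(* [a i] plays the role of [|f i| ^ (1 / q i)] and [v i] that of the integer part of its logarithm. *)
Record levels (n : nat) (q : nat -> R) (M H : Z) (f a : nat -> Z -> R) (v : nat -> Z -> Z) : Prop := {
  lv_supp : forall i, supp M (f i);
  lv_asupp : forall i, supp M (a i);
  lv_nonneg : forall i x, 0 <= a i x;
  lv_sum : forall i, (i < n)%nat -> lsum (zsym H) (a i) <= 1;
  lv_lower : forall i x, f i x <> 0 -> exp (IZR (v i x)) <= a i x;
  lv_upper : forall i x, (i < n)%nat -> Rabs (f i x) <= exp (q i * (IZR (v i x) + 1)) }.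
Arguments lv_supp {n q M H f a v} _.
Arguments lv_asupp {n q M H f a v} _.
Arguments lv_nonneg {n q M H f a v} _.
Arguments lv_sum {n q M H f a v} _.
Arguments lv_lower {n q M H f a v} _.
Arguments lv_upper {n q M H f a v} _.

Definition band_mass (n m : nat) (H : Z) (a : nat -> Z -> R) (v : nat -> Z -> Z) (l : Z) : R :=
  lsum (seq 0 n) (fun i => lsum (zsym H) (fun x => a i x * band m l (v i x))).

Lemma band_nonneg m l v : 0 <= band m l v.
Proof. destruct (band_cases m l v) as [[]|[]]; lra. Qed.

Lemma exp_le_compat x y : x <= y -> exp x <= exp y.
Proof. intros [L|<-]; [apply Rlt_le, exp_increasing; auto|lra]. Qed.

(** In the band [|f i| <= exp (q i (l + 1))]; dividing by these bounds costs [exp (l + 1)] in total,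
    since the [q i] sum to 1. Levels there are at least [l - m], so [1 <= exp (m - l) * a i] on the
    support, which bounds the mass. The two exponentials combine to [exp (m + 1)], free of [l]. *)
Lemma band_form_bound n q M H f a v m l w B :
  (forall i, (i < S n)%nat -> 0 < q i) -> lsum (seq 0 (S n)) q = 1 ->
  levels (S n) q M H f a v ->
  (forall A g, bounded_family M H A g -> Rabs (form H (S n) w g) <= B * A) ->
  Rabs (form H (S n) w (fun i x => band m l (v i x) * f i x))
  <= B * exp (INR m + 1) * band_mass (S n) m H a v l.
Proof.
  intros Hq Hsum Hl HB.
  (* Set to zero from index [S n] on, because [bounded_family] speaks of all indices and [lv_upper]
     only of those below [S n]. *)
  set (g := fun i x => if Nat.ltb i (S n)
                       then exp (- (q i * (IZR l + 1))) * (band m l (v i x) * f i x) else 0).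
  assert (Hterm : forall i, 0 <= lsum (zsym H) (fun x => a i x * band m l (v i x))).
  { intros i. apply lsum_nonneg; intros x _. apply Rmult_le_pos; [apply (lv_nonneg Hl)|apply band_nonneg]. }
  assert (Hmass : 0 <= band_mass (S n) m H a v l) by (apply lsum_nonneg; auto).
  assert (Hg1 : forall i x, Rabs (g i x) <= 1).
  { intros i x. unfold g. destruct (Nat.ltb_spec i (S n)) as [Hi|Hi]; [|rewrite Rabs_R0; lra].
    destruct (band_cases m l (v i x)) as [[-> L]|[-> L]].
    - rewrite Rmult_1_l, Rabs_mult, (Rabs_pos_eq (exp _)) by apply Rlt_le, exp_pos.
      rewrite exp_Ropp.
      apply Rmult_le_reg_l with (exp (q i * (IZR l + 1))); [apply exp_pos|].
      rewrite <- Rmult_assoc, Rinv_r, Rmult_1_l, Rmult_1_r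
        by (apply Rgt_not_eq, exp_pos).
      eapply Rle_trans; [apply (lv_upper Hl); auto|]. apply exp_le_compat.
      apply Rmult_le_compat_l; [specialize (Hq i Hi); lra|].
      assert (IZR (v i x) <= IZR l) by (apply IZR_le; lia). lra.
    - rewrite Rmult_0_l, Rmult_0_r, Rabs_R0. lra. }
  assert (Hg : bounded_family M H (exp (INR m - IZR l) * band_mass (S n) m H a v l) g).
  { split; auto.
    - intros i x Hx. unfold g. rewrite (lv_supp Hl i x Hx). destruct Nat.ltb; ring.
    - intros i. destruct (lt_dec i (S n)) as [Hi|Hi].
      + apply Rle_trans with (exp (INR m - IZR l)
                 * lsum (zsym H) (fun x => a i x * band m l (v i x))).
        * rewrite <- lsum_scal. apply lsum_le; intros x.
          destruct (Req_dec (f i x) 0) as [Ef|Ef].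
          { replace (g i x) with 0 by (unfold g; rewrite Ef; destruct Nat.ltb; ring).
            rewrite Rabs_R0. apply Rmult_le_pos; [apply Rlt_le, exp_pos|].
            apply Rmult_le_pos; [apply (lv_nonneg Hl)|apply band_nonneg]. }
          destruct (band_cases m l (v i x)) as [[Eb L]|[Eb L]].
          -- rewrite Eb, Rmult_1_r. eapply Rle_trans; [apply Hg1|].
             apply Rle_trans with (exp (INR m - IZR l) * exp (IZR (v i x))).
             ++ rewrite <- exp_plus, <- exp_0. apply exp_le_compat.
                rewrite INR_IZR_INZ, <- minus_IZR, <- plus_IZR. apply IZR_le. lia.
             ++ apply Rmult_le_compat_l; [apply Rlt_le, exp_pos|apply (lv_lower Hl); auto].
          -- replace (g i x) with 0 by (unfold g; rewrite Eb; destruct Nat.ltb; ring).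
             rewrite Eb, Rabs_R0, !Rmult_0_r. lra.
        * apply Rmult_le_compat_l; [apply Rlt_le, exp_pos|].
          apply (lsum_ge_term (seq 0 (S n))
                   (fun i => lsum (zsym H) (fun x => a i x * band m l (v i x))) i); auto.
          apply in_seq; lia.
      + rewrite lsum_zero; [apply Rmult_le_pos; [apply Rlt_le, exp_pos|auto]|].
        intros x _. unfold g. destruct (Nat.ltb_spec i (S n)); [lia|apply Rabs_R0]. }
  assert (E : form H (S n) w (fun i x => band m l (v i x) * f i x)
              = exp (IZR l + 1) * form H (S n) w g).
  { unfold form. rewrite <- lsum_scal. apply lsum_ext; intros x.
    rewrite <- lsum_scal. apply lsum_ext; intros t.
    rewrite (pr_ext (S n) (fun i => band m l (v i (x + Z.of_nat i * t)%Z) * f i (x + Z.of_nat i * t)%Z)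
       (fun i => exp (q i * (IZR l + 1)) * g i (x + Z.of_nat i * t)%Z)).
    - rewrite pr_mult, pr_exp, lsum_scal_r, Hsum, Rmult_1_l. ring.
    - intros i Hi. unfold g. destruct (Nat.ltb_spec i (S n)); [|lia].
      rewrite <- Rmult_assoc, <- exp_plus, Rplus_opp_r, exp_0. ring. }
  rewrite E, Rabs_mult, (Rabs_pos_eq (exp _)) by apply Rlt_le, exp_pos.
  eapply Rle_trans; [apply Rmult_le_compat_l; [apply Rlt_le, exp_pos|apply HB, Hg]|].
  replace (INR m + 1) with ((IZR l + 1) + (INR m - IZR l)) by ring.
  rewrite (exp_plus (IZR l + 1) (INR m - IZR l)). apply Req_le; ring.
Qed.

Lemma band_mass_sum n q M H f a v m L :
  levels n q M H f a v -> (0 <= L)%Z ->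
  lsum (zsym L) (band_mass n m H a v) <= (INR m + 1) * INR n.
Proof.
  intros Hl HL. unfold band_mass. rewrite lsum_swap.
  replace ((INR m + 1) * INR n) with (lsum (seq 0 n) (fun _ => INR m + 1))
    by (rewrite lsum_const, length_seq; ring).
  apply lsum_le_in; intros i Hi. apply in_seq in Hi.
  rewrite lsum_swap.
  apply Rle_trans with (lsum (zsym H) (fun x => a i x * (INR m + 1))).
  - apply lsum_le; intros x. rewrite lsum_scal.
    apply Rmult_le_compat_l; [apply (lv_nonneg Hl)|apply band_sum; auto].
  - rewrite lsum_scal_r. pose proof (lv_sum Hl i ltac:(lia)). pose proof (pos_INR m).
    rewrite <- (Rmult_1_l (INR m + 1)) at 2. apply Rmult_le_compat_r; lra.
Qed.

(** The count is off by at most the spread, and the smallness of products of large spread pays for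
    it. What is left is the exponential of the top level, charged to [a] at the factor attaining it;
    this is summable in [x]. *)
Lemma band_product_error n q c M H f a v m L x t :
  0 < c -> (forall i, (i < S n)%nat -> c <= q i) -> lsum (seq 0 (S n)) q = 1 ->
  levels (S n) q M H f a v ->
  (forall i y, (i < S n)%nat -> (Z.abs y <= M)%Z -> (Z.abs (v i y) + Z.of_nat m <= L)%Z) ->
  Rabs ((INR m + 1) * pr (S n) (fun i => f i (x + Z.of_nat i * t)%Z)
    - lsum (zsym L) (fun l => pr (S n) (fun i =>
        band m l (v i (x + Z.of_nat i * t)%Z) * f i (x + Z.of_nat i * t)%Z)))
  <= exp 1 / c * lsum (seq 0 (S n)) (fun i => a i (x + Z.of_nat i * t)%Z).
Proof.
  intros Hc Hcq Hsum Hl HL.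
  set (y := fun i => (x + Z.of_nat i * t)%Z).
  set (F := pr (S n) (fun i => f i (y i))).
  assert (Hsa : 0 <= lsum (seq 0 (S n)) (fun i => a i (y i)))
    by (apply lsum_nonneg; intros; apply (lv_nonneg Hl)).
  assert (Hec : 0 < exp 1 / c) by (apply Rdiv_lt_0_compat; [apply exp_pos|auto]).
  rewrite (lsum_ext _ _ (fun l => pr (S n) (fun i => band m l (v i (y i))) * F))
    by (intros l; apply (pr_mult (S n) (fun i => band m l (v i (y i))) (fun i => f i (y i)))).
  rewrite lsum_scal_r, <- Rmult_minus_distr_r, Rabs_mult.
  destruct (Req_dec F 0) as [EF|EF].
  { rewrite EF, Rabs_R0, Rmult_0_r. apply Rmult_le_pos; [lra|exact Hsa]. }
  assert (Hnz : forall i, (i < S n)%nat -> f i (y i) <> 0).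
  { intros i Hi E. apply EF. apply pr_zero with i; auto. }
  assert (HyM : forall i, (i < S n)%nat -> (Z.abs (y i) <= M)%Z).
  { intros i Hi. destruct (Z_le_gt_dec (Z.abs (y i)) M); auto.
    exfalso. apply (Hnz i Hi). apply (lv_supp Hl). lia. }
  destruct (exists_argmax n (fun i => v i (y i))) as [i1 [Hi1 E1]].
  destruct (exists_argmax n (fun i => (- v i (y i))%Z)) as [i0 [Hi0 E0]].
  assert (Hv : forall i, (i < S n)%nat -> (v i0 (y i0) <= v i (y i) <= v i1 (y i1))%Z).
  { intros i Hi. specialize (E1 i Hi). specialize (E0 i Hi). cbv beta in *. lia. }
  pose proof (band_product_count n m L (fun i => v i (y i)) i0 i1 Hi0 Hi1 Hv
                (fun i Hi => HL i (y i) Hi (HyM i Hi))) as Hcount.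
  pose proof (product_spread_bound n q c (fun i => v i (y i)) i0 i1 Hc Hcq Hsum Hi0 Hi1 Hv) as Hspread.
  cbv beta in *.
  apply Rle_trans with (IZR (v i1 (y i1) - v i0 (y i0)) * Rabs F).
  { apply Rmult_le_compat_r; [apply Rabs_pos|exact Hcount]. }
  assert (HF : Rabs F <= pr (S n) (fun i => exp (q i * (IZR (v i (y i)) + 1)))).
  { unfold F. rewrite pr_abs. apply pr_le. intros i Hi.
    split; [apply Rabs_pos|apply (lv_upper Hl); auto]. }
  rewrite Rmult_comm.
  eapply Rle_trans; [apply Rmult_le_compat_r; [|exact HF]|].
  { apply IZR_le. specialize (Hv i1 Hi1). lia. }
  eapply Rle_trans; [exact Hspread|].
  apply Rmult_le_compat_l; [lra|].
  eapply Rle_trans; [apply (lv_lower Hl), Hnz, Hi1|].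
  apply (lsum_ge_term (seq 0 (S n)) (fun i => a i (y i)) i1).
  - apply in_seq; lia.
  - intros; apply (lv_nonneg Hl).
Qed.

(** After division by [m + 1] the first term is [O(C / (m + 1))] for the trivial kernel norm [C],
    and the second is small once [B] is small in terms of [m]. *)
Lemma levels_form_bound n q c M H f a v m w B C :
  0 < c -> (forall i, (i < S n)%nat -> c <= q i) -> lsum (seq 0 (S n)) q = 1 ->
  (0 <= M <= H)%Z -> levels (S n) q M H f a v -> 0 <= B ->
  lsum (zsym H) (fun t => Rabs (w t)) <= C ->
  (forall A g, bounded_family M H A g -> Rabs (form H (S n) w g) <= B * A) ->
  (INR m + 1) * Rabs (form H (S n) w f)
  <= C * (exp 1 / c * INR (S n)) + B * exp (INR m + 1) * ((INR m + 1) * INR (S n)).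
Proof.
  intros Hc Hcq Hsum HM Hl HB0 HC HB.
  assert (Hq : forall i, (i < S n)%nat -> 0 < q i) by (intros i Hi; specialize (Hcq i Hi); lra).
  assert (Hec : 0 < exp 1 / c) by (apply Rdiv_lt_0_compat; [apply exp_pos|auto]).
  assert (Hm : 0 <= INR m) by apply pos_INR.
  (* Finite support leaves finitely many levels, so a finite range [[-L, L]] contains all relevant
     bands. *)
  destruct (exists_Zabs_bound (list_prod (seq 0 (S n)) (zsym M)) (fun p => v (fst p) (snd p)))
    as [L0 [HL0 HL]].
  set (L := (L0 + Z.of_nat m)%Z).
  assert (HL' : forall i y, (i < S n)%nat -> (Z.abs y <= M)%Z ->
            (Z.abs (v i y) + Z.of_nat m <= L)%Z).
  { intros i y Hi Hy. specialize (HL (i, y)). simpl in HL. unfold L.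
    assert (In (i, y) (list_prod (seq 0 (S n)) (zsym M)))
      by (apply in_prod; [apply in_seq; lia|apply in_zsym; lia]).
    specialize (HL H0). lia. }
  set (E := fun x t => (INR m + 1) * pr (S n) (fun i => f i (x + Z.of_nat i * t)%Z)
    - lsum (zsym L) (fun l => pr (S n) (fun i =>
        band m l (v i (x + Z.of_nat i * t)%Z) * f i (x + Z.of_nat i * t)%Z))).
  assert (Dec : (INR m + 1) * form H (S n) w f
    = lsum (zsym H) (fun t => w t * lsum (zsym H) (fun x => E x t))
      + lsum (zsym L) (fun l => form H (S n) w (fun i x => band m l (v i x) * f i x))).
  { rewrite (lsum_ext (zsym H) (fun t => w t * lsum (zsym H) (fun x => E x t))
       (fun t => lsum (zsym H) (fun x => w t * E x t))) by (intros; symmetry; apply lsum_scal).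
    rewrite (lsum_swap (zsym H) (zsym H) (fun t x => w t * E x t)).
    unfold form. rewrite (lsum_swap (zsym L)), <- lsum_scal, <- lsum_plus.
    apply lsum_ext; intros x. rewrite (lsum_swap (zsym L)), <- lsum_scal, <- lsum_plus.
    apply lsum_ext; intros t. rewrite lsum_scal. unfold E. ring. }
  rewrite <- (Rabs_pos_eq (INR m + 1)) at 1 by lra. rewrite <- Rabs_mult, Dec.
  eapply Rle_trans; [apply Rabs_triang|]. apply Rplus_le_compat.
  - apply lsum_abs_mult_le; auto.
    + apply Rmult_le_pos; [lra|apply pos_INR].
    + intros t _ _. eapply Rle_trans; [apply lsum_abs|].
      apply Rle_trans with (lsum (zsym H) (fun x => exp 1 / c
          * lsum (seq 0 (S n)) (fun i => a i (x + Z.of_nat i * t)%Z))).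
      * apply lsum_le; intros x. apply (band_product_error n q c M H); auto.
      * rewrite lsum_scal. apply Rmult_le_compat_l; [lra|].
        rewrite lsum_swap.
        replace (INR (S n)) with (lsum (seq 0 (S n)) (fun _ => 1))
          by (rewrite lsum_const, length_seq; ring).
        apply lsum_le_in; intros i Hi. apply in_seq in Hi.
        eapply Rle_trans; [apply (lsum_zsym_shift_le M H (a i) (Z.of_nat i * t)); auto|].
        -- apply (lv_asupp Hl).
        -- apply (lv_nonneg Hl).
        -- apply (lv_sum Hl). lia.
  - eapply Rle_trans; [apply lsum_abs|].
    apply Rle_trans with (lsum (zsym L) (fun l => B * exp (INR m + 1) * band_mass (S n) m H a v l)).
    + apply lsum_le; intros l. eapply band_form_bound; eauto.
    + rewrite lsum_scal. apply Rmult_le_compat_l.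
      * apply Rmult_le_pos; [auto|apply Rlt_le, exp_pos].
      * eapply band_mass_sum; eauto. unfold L. lia.
Qed.

(** Where [f i x = 0] the logarithm is a default value and the level has no meaning; [lv_lower]
    excludes such points and [lv_upper] is trivial there. *)
Lemma levels_of_functions n q M H f :
  (forall i, (i < n)%nat -> 0 < q i) -> (forall i, supp M (f i)) ->
  (forall i, (i < n)%nat -> lsum (zsym H) (fun x => rpow (Rabs (f i x)) (/ q i)) <= 1) ->
  levels n q M H f (fun i x => rpow (Rabs (f i x)) (/ q i))
    (fun i x => Int_part (/ q i * ln (Rabs (f i x)))).
Proof.
  intros Hq Hs Hsum.
  assert (Hint : forall z, IZR (Int_part z) <= z < IZR (Int_part z) + 1)
    by (intros z; destruct (base_Int_part z); lra).
  split; auto.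
  - intros i x Hx. rewrite (Hs i x Hx), Rabs_R0. unfold rpow.
    destruct Req_EM_T; [reflexivity|contradiction].
  - intros i x. unfold rpow. destruct Req_EM_T; [lra|apply Rlt_le, exp_pos].
  - intros i x Hx. unfold rpow. destruct Req_EM_T as [E|E].
    + exfalso. apply (Rabs_no_R0 _ Hx). auto.
    + unfold Rpower. apply exp_le_compat. apply Hint.
  - intros i x Hi. specialize (Hq i Hi). destruct (Req_dec (f i x) 0) as [E|E].
    + rewrite E, Rabs_R0. apply Rlt_le, exp_pos.
    + rewrite <- (exp_ln (Rabs (f i x))) at 1 by (apply Rabs_pos_lt; auto).
      apply exp_le_compat.
      destruct (Hint (/ q i * ln (Rabs (f i x)))) as [_ L].
      apply Rlt_le, (Rmult_le_compat_l (q i)) in L; [|lra].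
      rewrite <- Rmult_assoc, Rinv_r, Rmult_1_l in L by lra. exact L.
Qed.

Lemma hilbert_form_normalized n q eps :
  (forall i, (i < S n)%nat -> 0 < q i) -> lsum (seq 0 (S n)) q = 1 -> 0 < eps ->
  exists K, forall r Rb, 1 <= r -> r <= Rb -> K <= Rb / r ->
  forall M H f, (0 <= M)%Z -> Rb <= IZR M -> (2 * M <= H)%Z ->
  (forall i, supp M (f i)) ->
  (forall i, (i < S n)%nat -> lsum (zsym H) (fun x => rpow (Rabs (f i x)) (/ q i)) <= 1) ->
  Rabs (form H (S n) (hilbert_kernel r Rb) f) <= eps * ln (Rb / r).
Proof.
  intros Hq Hsum He.
  destruct (exists_lower_bound (S n) q Hq) as [c [Hc Hcq]].
  set (N := INR (S n)).
  assert (HN : 0 < N) by (apply lt_0_INR; lia).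
  pose proof (exp_pos 1) as He1.
  (* Makes the error term, with kernel norm [12 l], at most half of [(m + 1) * eps * l]; the next
     choice of [d], made after [m], does the same for the bands. *)
  destruct (exists_INR_ge (24 * (exp 1 / c * N) / eps)) as [m Hm].
  pose proof (exp_pos (INR m + 1)) as Hem. pose proof (pos_INR m) as Hm0.
  set (d := eps / (2 * (exp (INR m + 1) * N))).
  assert (HeN : 0 < exp (INR m + 1) * N) by (apply Rmult_lt_0_compat; auto).
  assert (Hd : 0 < d) by (apply Rdiv_lt_0_compat; lra).
  destruct (hilbert_form_bounded n d Hd) as [K HK].
  exists (Rmax K (exp 1)). intros r Rb Hr HR HKR M H f HM HRM HH Hs Hf.
  assert (HKR1 : K <= Rb / r) by (eapply Rle_trans; [apply Rmax_l|exact HKR]).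
  assert (HKR2 : exp 1 <= Rb / r) by (eapply Rle_trans; [apply Rmax_r|exact HKR]).
  set (l := ln (Rb / r)) in *.
  assert (Hl : 1 <= l).
  { unfold l. rewrite <- (ln_exp 1). apply ln_le_compat; [apply exp_pos|auto]. }
  assert (Hdl : 0 <= d * l) by (apply Rmult_le_pos; lra).
  pose proof (levels_form_bound n q c M H f _ _ m (hilbert_kernel r Rb) (d * l) (12 * l)
    Hc Hcq Hsum ltac:(lia) (levels_of_functions (S n) q M H f Hq Hs Hf) Hdl
    (hilbert_kernel_norm r Rb H Hr HR HKR2 ltac:(lia))
    (fun A g Hg => HK r Rb Hr HR HKR1 M H A g HM HRM HH Hg)) as P.
  fold N in P.
  apply Rmult_le_reg_l with (INR m + 1); [lra|].
  eapply Rle_trans; [exact P|].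
  assert (E : d * l * exp (INR m + 1) * ((INR m + 1) * N) = (INR m + 1) * (eps / 2 * l)).
  { unfold d. field. lra. }
  rewrite E.
  assert (12 * (exp 1 / c * N) <= (INR m + 1) * (eps / 2)).
  { apply (Rmult_le_compat_r (eps / 2)) in Hm; [|lra].
    replace (24 * (exp 1 / c * N) / eps * (eps / 2)) with (12 * (exp 1 / c * N)) in Hm
      by (field; lra). lra. }
  assert (12 * l * (exp 1 / c * N) <= (INR m + 1) * (eps / 2 * l)).
  { replace (12 * l * (exp 1 / c * N)) with (12 * (exp 1 / c * N) * l) by ring.
    rewrite <- (Rmult_assoc (INR m + 1)). apply Rmult_le_compat_r; lra. }
  lra.
Qed.

(** * Powers, complex values and duality *)

Lemma rpow_0 a : rpow 0 a = 0.
Proof. unfold rpow. destruct Req_EM_T; [reflexivity|contradiction]. Qed.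

Lemma rpow_Rpower x a : x <> 0 -> rpow x a = Rpower x a.
Proof. intros Hx. unfold rpow. destruct Req_EM_T; [contradiction|reflexivity]. Qed.

Lemma Rpower_pos x a : 0 < Rpower x a.
Proof. apply exp_pos. Qed.

Lemma rpow_nonneg x a : 0 <= rpow x a.
Proof. unfold rpow. destruct Req_EM_T; [lra|apply Rlt_le, Rpower_pos]. Qed.

Lemma rpow_mono x y a : 0 < a -> 0 <= x -> x <= y -> rpow x a <= rpow y a.
Proof.
  intros Ha Hx Hxy. destruct (Req_dec x 0) as [->|Ex].
  - rewrite rpow_0. apply rpow_nonneg.
  - rewrite !rpow_Rpower by lra. apply Rle_Rpower_l; lra.
Qed.

Lemma rpow_mult_distr x y a : 0 < x -> 0 <= y -> rpow (x * y) a = Rpower x a * rpow y a.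
Proof.
  intros Hx Hy. destruct (Req_dec y 0) as [->|Ey].
  - rewrite Rmult_0_r, rpow_0. ring.
  - rewrite !rpow_Rpower by (try apply Rmult_integral_contrapositive_currified; lra).
    symmetry; apply Rpower_mult_distr; lra.
Qed.

Lemma rpow_eq_0 x a : rpow x a = 0 -> x = 0.
Proof.
  unfold rpow. destruct Req_EM_T; auto. intros E. pose proof (Rpower_pos x a). lra.
Qed.

(** Homogeneity: each [f i] is divided by [N i ^ q i]. *)
Lemma hilbert_form_estimate n q eps :
  (forall i, (i < S n)%nat -> 0 < q i) -> lsum (seq 0 (S n)) q = 1 -> 0 < eps ->
  exists K, forall r Rb, 1 <= r -> r <= Rb -> K <= Rb / r ->
  forall M H f N, (0 <= M)%Z -> Rb <= IZR M -> (2 * M <= H)%Z ->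
  (forall i, supp M (f i)) -> (forall i, (i < S n)%nat -> 0 < N i) ->
  (forall i, (i < S n)%nat -> lsum (zsym H) (fun x => rpow (Rabs (f i x)) (/ q i)) <= N i) ->
  Rabs (form H (S n) (hilbert_kernel r Rb) f)
  <= eps * ln (Rb / r) * pr (S n) (fun i => Rpower (N i) (q i)).
Proof.
  intros Hq Hsum He. destruct (hilbert_form_normalized n q eps Hq Hsum He) as [K HK].
  exists K. intros r Rb Hr HR HKR M H f N HM HRM HH Hs HN Hf.
  set (h := fun i x => Rpower (N i) (- q i) * f i x).
  specialize (HK r Rb Hr HR HKR M H h HM HRM HH).
  assert (E : form H (S n) (hilbert_kernel r Rb) f
    = pr (S n) (fun i => Rpower (N i) (q i)) * form H (S n) (hilbert_kernel r Rb) h).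
  { unfold form. rewrite <- lsum_scal. apply lsum_ext; intros x.
    rewrite <- lsum_scal. apply lsum_ext; intros t.
    rewrite (pr_ext (S n) (fun i => f i (x + Z.of_nat i * t)%Z)
      (fun i => Rpower (N i) (q i) * h i (x + Z.of_nat i * t)%Z)).
    - rewrite pr_mult. ring.
    - intros i Hi. unfold h. rewrite <- Rmult_assoc, <- Rpower_plus, Rplus_opp_r.
      rewrite Rpower_O by auto. ring. }
  assert (Hp : 0 <= pr (S n) (fun i => Rpower (N i) (q i))).
  { apply (pr_le (S n) (fun i => Rpower (N i) (q i)) (fun i => Rpower (N i) (q i))).
    intros i _. split; [apply Rlt_le, Rpower_pos|lra]. }
  rewrite E, Rabs_mult, Rabs_pos_eq by auto. rewrite (Rmult_comm (eps * _)).
  apply Rmult_le_compat_l; auto. apply HK.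
  - intros i x Hx. unfold h. rewrite (Hs i x Hx). ring.
  - intros i Hi. specialize (HN i Hi). specialize (Hf i Hi). specialize (Hq i Hi).
    rewrite (lsum_ext _ _ (fun x => / N i * rpow (Rabs (f i x)) (/ q i))).
    + rewrite lsum_scal. rewrite <- (Rinv_l (N i)) by lra.
      apply Rmult_le_compat_l; auto. apply Rlt_le, Rinv_0_lt_compat; auto.
    + intros x. unfold h. rewrite Rabs_mult, (Rabs_pos_eq (Rpower _ _))
        by apply Rlt_le, Rpower_pos.
      rewrite rpow_mult_distr by (try apply Rpower_pos; apply Rabs_pos).
      rewrite Rpower_mult. replace (- q i * / q i) with (- (1)) by (field; lra).
      rewrite Rpower_Ropp, Rpower_1 by auto. reflexivity.
Qed.

Lemma prodR_ext k g h : (forall i, (1 <= i <= k)%nat -> g i = h i) -> prodR k g = prodR k h.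
Proof.
  induction k as [|k IH]; intros E; simpl; [reflexivity|].
  rewrite IH, (E (S k)) by (intros; try apply E; lia). reflexivity.
Qed.

Lemma pr_last n : forall F, pr (S n) F = pr n F * F n.
Proof.
  induction n as [|n IH]; intros F; [simpl; ring|].
  change (pr (S (S n)) F) with (F O * pr (S n) (fun i => F (S i))).
  rewrite IH. simpl. ring.
Qed.

Lemma pr_prodR k g : pr k (fun i => g (S i)) = prodR k g.
Proof.
  induction k as [|k IH]; [reflexivity|]. rewrite pr_last, IH. reflexivity.
Qed.

Lemma lsum_sumR k g : lsum (seq 0 (S k)) g = g O + sumR k g.
Proof.
  induction k as [|k IH]; [simpl; ring|].
  rewrite seq_split_last, lsum_app, IH.
  change (lsum (S k :: nil) g) with (g (S k) + 0). simpl. ring.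
Qed.

Lemma lsum_list_prod {A B} (l : list A) (l' : list B) g :
  lsum (list_prod l l') g = lsum l (fun a => lsum l' (fun b => g (a, b))).
Proof.
  induction l as [|a l IH]; simpl; [reflexivity|].
  rewrite lsum_app, lsum_map, IH. reflexivity.
Qed.

(** * Real and imaginary parts, cutoffs and the dual estimate *)

Definition component (b : bool) (z : Cx) : R := if b then fst z else snd z.

(** Expanding a complex product into parts gives two terms per factor, hence [2^k] real products.
    The weight [w] is arbitrary so that the induction can move a part of the last factor into it. *)
Lemma prodC_components {A} k : forall (l : list A) (w : A -> R) (g : A -> nat -> Cx) B,
  0 <= B ->
  (forall sg : nat -> bool,
    Rabs (lsum l (fun z => w z * prodR k (fun i => component (sg i) (g z i)))) <= B) ->
  forall b, Rabs (lsum l (fun z => w z * component b (prodC k (g z)))) <= 2 ^ k * B.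
Proof.
  induction k as [|k IH]; intros l w g B HB Hw b.
  - specialize (Hw (fun _ => true)). simpl in *. destruct b; simpl; [lra|].
    rewrite lsum_zero; [rewrite Rabs_R0; lra|intros; ring].
  - assert (P : forall b1 b2, Rabs (lsum l (fun z =>
        (w z * component b2 (g z (S k))) * component b1 (prodC k (g z)))) <= 2 ^ k * B).
    { intros b1 b2. apply IH; auto. intros sg.
      specialize (Hw (fun i => if Nat.eqb i (S k) then b2 else sg i)).
      rewrite (lsum_ext _ _ (fun z => w z * prodR (S k) (fun i =>
          component (if Nat.eqb i (S k) then b2 else sg i) (g z i)))); auto.
      intros z. cbn [prodR]. rewrite Nat.eqb_refl.
      rewrite (prodR_ext k (fun i => component (if Nat.eqb i (S k) then b2 else sg i) (g z i))
        (fun i => component (sg i) (g z i))); [ring|].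
      intros i Hi. destruct (Nat.eqb_spec i (S k)); [lia|reflexivity]. }
    assert (Q : forall s1 s2, s1 <= 2 ^ k * B -> s2 <= 2 ^ k * B -> s1 + s2 <= 2 ^ S k * B)
      by (intros; simpl; lra).
    destruct b.
    + rewrite (lsum_ext _ _ (fun z =>
        (w z * component true (g z (S k))) * component true (prodC k (g z))
        - (w z * component false (g z (S k))) * component false (prodC k (g z))))
        by (intros z; simpl; ring).
      rewrite lsum_minus. eapply Rle_trans; [apply Rabs_triang|]. rewrite Rabs_Ropp.
      apply Q; apply P.
    + rewrite (lsum_ext _ _ (fun z =>
        (w z * component false (g z (S k))) * component true (prodC k (g z))
        + (w z * component true (g z (S k))) * component false (prodC k (g z))))
        by (intros z; simpl; ring).
      rewrite lsum_plus. eapply Rle_trans; [apply Rabs_triang|].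
      apply Q; apply P.
Qed.

Lemma component_sumC_from b g n : forall a,
  component b (sumC_from a n g) = lsum (zr a n) (fun t => component b (g t)).
Proof.
  induction n as [|n IH]; intros a; [destruct b; reflexivity|].
  cbn [sumC_from zr]. change (lsum (a :: zr (a + 1) n) (fun t => component b (g t)))
    with (component b (g a) + lsum (zr (a + 1) n) (fun t => component b (g t))).
  rewrite <- IH. destruct b; reflexivity.
Qed.

Lemma component_trunc_op b k f r Rb x :
  component b (trunc_op k f r Rb x)
  = lsum (zsym (up Rb)) (fun t => hilbert_kernel r Rb t
      * component b (prodC k (fun i => f i (x + Z.of_nat i * t)%Z))).
Proof.
  unfold trunc_op. cbv zeta. rewrite component_sumC_from. apply lsum_ext; intros t.
  unfold hilbert_kernel. destruct (Rle_dec r _); [destruct (Rle_dec _ Rb)|];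
    destruct b; simpl; ring.
Qed.

Lemma component_le_Cmod b z : Rabs (component b z) <= Cmod z.
Proof.
  unfold Cmod. rewrite <- sqrt_Rsqr_abs. apply sqrt_le_1_alt. unfold Rsqr.
  destruct b; simpl; nra.
Qed.

Lemma Cmod_nonneg z : 0 <= Cmod z.
Proof. apply sqrt_pos. Qed.

Lemma Cmod_le_components z : Cmod z <= Rabs (fst z) + Rabs (snd z).
Proof.
  unfold Cmod. pose proof (Rabs_pos (fst z)). pose proof (Rabs_pos (snd z)).
  rewrite <- (sqrt_pow2 (Rabs (fst z) + Rabs (snd z))) by lra.
  apply sqrt_le_1_alt. rewrite <- (pow2_abs (fst z)), <- (pow2_abs (snd z)). nra.
Qed.

Lemma rpow_Cmod_le z p : 0 < p ->
  rpow (Cmod z) p <= Rpower 2 p * (rpow (Rabs (fst z)) p + rpow (Rabs (snd z)) p).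
Proof.
  intros Hp. pose proof (Cmod_le_components z) as Hz. pose proof (Cmod_nonneg z).
  pose proof (Rabs_pos (fst z)). pose proof (Rabs_pos (snd z)).
  assert (P : forall u, 0 <= u -> Cmod z <= 2 * u ->
              rpow (Cmod z) p <= Rpower 2 p * rpow u p).
  { intros u Hu Hle. rewrite <- rpow_mult_distr by lra. apply rpow_mono; auto. }
  pose proof (rpow_nonneg (Rabs (fst z)) p). pose proof (rpow_nonneg (Rabs (snd z)) p).
  pose proof (Rpower_pos 2 p).
  destruct (Rle_dec (Rabs (fst z)) (Rabs (snd z))).
  - eapply Rle_trans; [apply (P (Rabs (snd z))); lra|]. apply Rmult_le_compat_l; lra.
  - eapply Rle_trans; [apply (P (Rabs (fst z))); lra|]. apply Rmult_le_compat_l; lra.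
Qed.

Definition restrict (M : Z) (g : Z -> R) (x : Z) : R :=
  if Z.leb (Z.abs x) M then g x else 0.

Lemma restrict_supp M g : supp M (restrict M g).
Proof. intros x Hx. unfold restrict. destruct (Z.leb_spec (Z.abs x) M); [lia|reflexivity]. Qed.

Lemma restrict_in M g x : (Z.abs x <= M)%Z -> restrict M g x = g x.
Proof. intros Hx. unfold restrict. destruct (Z.leb_spec (Z.abs x) M); [reflexivity|lia]. Qed.

Lemma hilbert_kernel_supp r Rb : supp (up Rb) (hilbert_kernel r Rb).
Proof.
  intros t Ht. unfold hilbert_kernel. rewrite <- abs_IZR. apply IZR_lt in Ht.
  destruct (archimed Rb) as [U _].
  destruct (Rle_dec r _); [destruct (Rle_dec _ Rb); [lra|]|]; reflexivity.
Qed.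

(** Only [|x| <= X] and [|t| <= up Rb] contribute, and then every [x + i t] lies in [[-M, M]]:
    passing to finite support changes nothing. *)
Lemma form_restrict k r Rb X M (u : Z -> R) (g : nat -> Z -> R) :
  0 <= Rb -> (0 <= X)%Z -> (X + (Z.of_nat k + 1) * up Rb <= M)%Z ->
  form (2 * M) (S k) (hilbert_kernel r Rb)
    (fun i => match i with O => restrict X u | S _ => restrict M (g i) end)
  = lsum (zsym X) (fun x => lsum (zsym (up Rb)) (fun t =>
      u x * hilbert_kernel r Rb t * prodR k (fun i => g i (x + Z.of_nat i * t)%Z))).
Proof.
  intros HR HX HM. destruct (archimed Rb) as [U _].
  assert (HN : (0 <= up Rb)%Z) by (apply le_IZR; lra).
  assert (HM' : (0 <= Z.of_nat k * up Rb)%Z) by nia.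
  unfold form. rewrite (lsum_zsym_supp X).
  - apply lsum_ext_in; intros x Hx. apply in_zsym in Hx.
    rewrite (lsum_zsym_supp (up Rb)).
    + apply lsum_ext_in; intros t Ht. apply in_zsym in Ht. cbn [pr].
      replace (x + Z.of_nat 0 * t)%Z with x by lia. rewrite restrict_in by lia.
      rewrite <- pr_prodR. rewrite <- Rmult_assoc, (Rmult_comm (hilbert_kernel r Rb t)).
      f_equal. apply pr_ext. intros i Hi. apply restrict_in. nia.
    + intros t Ht. rewrite (hilbert_kernel_supp r Rb t Ht). ring.
    + nia.
  - intros x Hx. apply lsum_zero; intros t _. cbn [pr].
    replace (x + Z.of_nat 0 * t)%Z with x by lia.
    rewrite (restrict_supp X u x Hx). ring.
  - nia.
Qed.

(* Duality: test the operator against [sign(U) |U|^(p-1)] on [|x| <= X]. *)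
Lemma component_lp_bound k ps p eps :
  (forall i, (1 <= i <= k)%nat -> 1 < ps i) -> 1 < p ->
  / p = sumR k (fun i => / ps i) -> 0 < eps ->
  exists K, forall r Rb, 1 <= r -> r <= Rb -> K <= Rb / r -> exp 1 <= Rb / r ->
  forall f S, (forall i, (1 <= i <= k)%nat -> 0 < S i) ->
  (forall i, (1 <= i <= k)%nat -> forall H, lsum (zsym H) (fun x => rpow (Cmod (f i x)) (ps i)) <= S i) ->
  forall b X, (0 <= X)%Z ->
  lsum (zsym X) (fun x => rpow (Rabs (component b (trunc_op k f r Rb x))) p)
  <= Rpower (2 ^ k * (eps * ln (Rb / r) * prodR k (fun i => Rpower (S i) (/ ps i)))) p.
Proof.
  intros Hps Hp Hsum He.
  (* The test function takes the conjugate exponent, so that the reciprocals sum to 1. *)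
  set (q := fun i => match i with O => 1 - / p | S _ => / ps i end).
  assert (Hip : 0 < / p < 1).
  { split; [apply Rinv_0_lt_compat; lra|]. rewrite <- Rinv_1. apply Rinv_lt_contravar; lra. }
  assert (Hq : forall i, (i < S k)%nat -> 0 < q i).
  { intros [|i] Hi; simpl; [lra|]. apply Rinv_0_lt_compat. specialize (Hps (S i) ltac:(lia)). lra. }
  assert (Hq1 : lsum (seq 0 (S k)) q = 1).
  { rewrite lsum_sumR. replace (sumR k q) with (/ p); [simpl; ring|].
    rewrite Hsum. clear. induction k as [|k IH]; simpl; [reflexivity|rewrite IH; reflexivity]. }
  destruct (hilbert_form_estimate k q eps Hq Hq1 He) as [K HK].
  exists K. intros r Rb Hr HR HKR HeR f S HS Hf b X HX.
  set (U := fun x => component b (trunc_op k f r Rb x)).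
  set (Sg := lsum (zsym X) (fun x => rpow (Rabs (U x)) p)).
  set (l := ln (Rb / r)).
  set (P := prodR k (fun i => Rpower (S i) (/ ps i))).
  assert (HP : 0 < P).
  { unfold P. clear. induction k as [|k IH]; simpl; [lra|].
    apply Rmult_lt_0_compat; [auto|apply Rpower_pos]. }
  assert (Hl : 1 <= l).
  { unfold l. rewrite <- (ln_exp 1). apply ln_le_compat; [apply exp_pos|auto]. }
  assert (HB : 0 < 2 ^ k * (eps * l * P)).
  { apply Rmult_lt_0_compat; [apply pow_lt; lra|]. repeat apply Rmult_lt_0_compat; lra. }
  assert (HSg0 : 0 <= Sg) by (apply lsum_nonneg; intros; apply rpow_nonneg).
  change (Sg <= Rpower (2 ^ k * (eps * l * P)) p).
  destruct HSg0 as [HSg|HSg]; [|rewrite <- HSg; apply Rlt_le, Rpower_pos].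
  set (u := fun x => (if Rle_dec 0 (U x) then 1 else -1) * rpow (Rabs (U x)) (p - 1)).
  assert (HuU : forall x, u x * U x = rpow (Rabs (U x)) p).
  { intros x. unfold u. destruct (Req_dec (U x) 0) as [E|E].
    - rewrite E, Rabs_R0, !rpow_0. ring.
    - pose proof (Rabs_pos_lt _ E). rewrite !rpow_Rpower by lra.
      replace p with ((p - 1) + 1) at 2 by ring. rewrite Rpower_plus, (Rpower_1 (Rabs (U x))) by auto.
      destruct (Rle_dec 0 (U x)).
      + rewrite (Rabs_pos_eq (U x)) by auto. ring.
      + rewrite (Rabs_left (U x)) by lra. ring. }
  (* The exponents match because [(p - 1) / (1 - 1/p) = p], so the mass of the test function is
     again [Sg]. *)
  assert (Huq : forall x, rpow (Rabs (u x)) (/ (1 - / p)) = rpow (Rabs (U x)) p).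
  { intros x. assert (E : Rabs (u x) = rpow (Rabs (U x)) (p - 1)).
    { unfold u. rewrite Rabs_mult, (Rabs_pos_eq (rpow _ _)) by apply rpow_nonneg.
      destruct (Rle_dec 0 (U x)); [rewrite Rabs_R1|rewrite Rabs_left by lra]; ring. }
    rewrite E. destruct (Req_dec (U x) 0) as [E0|E0].
    - rewrite E0, Rabs_R0, !rpow_0. reflexivity.
    - pose proof (Rabs_pos_lt _ E0). pose proof (Rpower_pos (Rabs (U x)) (p - 1)).
      rewrite !rpow_Rpower by (rewrite ?rpow_Rpower; lra).
      rewrite Rpower_mult. f_equal. field. split; lra. }
  set (N := up Rb). destruct (archimed Rb) as [UR _]. fold N in UR.
  assert (HN : (0 <= N)%Z) by (apply le_IZR; lra).
  set (M := (X + (Z.of_nat k + 1) * N)%Z).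
  assert (HMN : (N <= M)%Z) by (unfold M; nia).
  set (Ns := fun i => match i with O => Sg | Datatypes.S _ => S i end).
  assert (HNs : forall i, (i < Datatypes.S k)%nat -> 0 < Ns i).
  { intros [|i] Hi; simpl; [auto|apply HS; lia]. }
  assert (Bound : forall sg : nat -> bool,
    Rabs (lsum (list_prod (zsym X) (zsym N)) (fun z => u (fst z) * hilbert_kernel r Rb (snd z)
       * prodR k (fun i => component (sg i) (f i (fst z + Z.of_nat i * snd z)%Z))))
    <= eps * l * (Rpower Sg (1 - / p) * P)).
  { intros sg. rewrite lsum_list_prod. cbn [fst snd].
    unfold N.
    rewrite <- (form_restrict k r Rb X M u (fun i y => component (sg i) (f i y)));
      [|lra|auto|unfold M, N; lia].
    eapply Rle_trans; [apply (HK r Rb Hr HR HKR M (2 * M)%Z _ Ns); auto|].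
    - lia.
    - apply IZR_le in HMN. lra.
    - lia.
    - intros [|i]; [|apply restrict_supp].
      intros x Hx. apply restrict_supp. unfold M in Hx. nia.
    - intros [|i] Hi.
      + cbn [q Ns]. rewrite (lsum_zsym_supp X).
        * apply Req_le. unfold Sg. apply lsum_ext_in; intros x Hx. apply in_zsym in Hx.
          rewrite restrict_in by lia. apply Huq.
        * intros x Hx. rewrite restrict_supp, Rabs_R0 by auto. apply rpow_0.
        * unfold M. nia.
      + cbn [q Ns]. rewrite Rinv_inv.
        eapply Rle_trans; [|apply (Hf (Datatypes.S i) ltac:(lia) (2 * M)%Z)].
        apply lsum_le; intros x. specialize (Hps (Datatypes.S i) ltac:(lia)).
        unfold restrict. destruct (Z.leb (Z.abs x) M).
        * apply rpow_mono; [lra|apply Rabs_pos|apply component_le_Cmod].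
        * rewrite Rabs_R0, rpow_0. apply rpow_nonneg.
    - fold l. apply Req_le. cbn [pr].
      rewrite (pr_prodR k (fun i => Rpower (Ns i) (q i))). f_equal. f_equal.
      apply prodR_ext. intros [|i] Hi; [lia|reflexivity]. }
  assert (HB0 : 0 <= eps * l * (Rpower Sg (1 - / p) * P)).
  { pose proof (Rpower_pos Sg (1 - / p)). apply Rlt_le.
    repeat apply Rmult_lt_0_compat; lra. }
  pose proof (prodC_components k _ _ (fun z i => f i (fst z + Z.of_nat i * snd z)%Z) _ HB0 Bound b) as T.
  rewrite lsum_list_prod in T. cbn [fst snd] in T.
  assert (E : lsum (zsym X) (fun x => lsum (zsym N) (fun t => u x * hilbert_kernel r Rb t
      * component b (prodC k (fun i => f i (x + Z.of_nat i * t)%Z)))) = Sg).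
  { unfold Sg. apply lsum_ext; intros x. rewrite <- HuU. unfold U.
    rewrite component_trunc_op, <- lsum_scal. apply lsum_ext; intros t. ring. }
  rewrite E, Rabs_pos_eq in T by lra.
  (* At this point [T] bounds [Sg] by a constant times [Sg^(1 - 1/p)]. As [Sg] is a finite positive
     sum, that power can be cancelled. *)
  assert (E2 : Sg = Rpower Sg (/ p) * Rpower Sg (1 - / p)).
  { rewrite <- Rpower_plus. replace (/ p + (1 - / p)) with 1 by ring. rewrite Rpower_1; auto. }
  assert (R1 : Rpower Sg (/ p) <= 2 ^ k * (eps * l * P)).
  { apply Rmult_le_reg_r with (Rpower Sg (1 - / p)); [apply Rpower_pos|].
    rewrite <- E2. lra. }
  replace Sg with (Rpower (Rpower Sg (/ p)) p).
  - apply Rle_Rpower_l; [lra|]. split; [apply Rpower_pos|exact R1].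
  - rewrite Rpower_mult, Rinv_l, Rpower_1 by lra. reflexivity.
Qed.

(** The enumeration [n, -n-1] covers [[-n-1, n]], one point more than the symmetric interval. *)
Lemma lp_partial_sum (g : Z -> R) n :
  sum_f_R0 (fun n => g (Z.of_nat n) + g (- Z.of_nat n - 1)%Z) n
  = g (- Z.of_nat n - 1)%Z + lsum (zsym (Z.of_nat n)) g.
Proof.
  induction n as [|n IH].
  - unfold zsym. simpl. ring.
  - cbn [sum_f_R0]. rewrite IH. unfold zsym.
    replace (Z.to_nat (2 * Z.of_nat (S n) + 1)) with (1 + (Z.to_nat (2 * Z.of_nat n + 1) + 1))%nat
      by lia.
    rewrite !zr_app, !lsum_app.
    replace (- Z.of_nat (S n) + Z.of_nat 1)%Z with (- Z.of_nat n)%Z by lia.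
    replace (- Z.of_nat n + Z.of_nat (Z.to_nat (2 * Z.of_nat n + 1)))%Z with (Z.of_nat (S n)) by lia.
    replace (- Z.of_nat n - 1)%Z with (- Z.of_nat (S n))%Z by lia.
    unfold lsum. cbn [zr fold_right]. ring.
Qed.

Lemma lp_pow_sum_partial p g S :
  lp_pow_sum p g S -> forall H, lsum (zsym H) (fun x => rpow (Cmod (g x)) p) <= S.
Proof.
  intros HS H.
  assert (Hn : forall n, 0 <= rpow (Cmod (g (Z.of_nat n))) p + rpow (Cmod (g (- Z.of_nat n - 1)%Z)) p).
  { intros n. pose proof (rpow_nonneg (Cmod (g (Z.of_nat n))) p).
    pose proof (rpow_nonneg (Cmod (g (- Z.of_nat n - 1)%Z)) p). lra. }
  pose proof (sum_incr _ (Z.to_nat H) S HS Hn) as L.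
  rewrite (lp_partial_sum (fun x => rpow (Cmod (g x)) p)) in L.
  pose proof (rpow_nonneg (Cmod (g (- Z.of_nat (Z.to_nat H) - 1)%Z)) p).
  destruct (Z_le_gt_dec 0 H).
  - rewrite Z2Nat.id in * by auto. lra.
  - unfold zsym at 1. replace (Z.to_nat (2 * H + 1)) with O by lia.
    pose proof (sum_incr _ 0 S HS Hn). specialize (Hn O). simpl in *. lra.
Qed.

Lemma lp_pow_sum_exists p g B :
  (forall X, (0 <= X)%Z -> lsum (zsym X) (fun x => rpow (Cmod (g x)) p) <= B) ->
  exists S, lp_pow_sum p g S /\ 0 <= S <= B.
Proof.
  intros HB.
  set (s := fun n => sum_f_R0 (fun n => rpow (Cmod (g (Z.of_nat n))) p
                                + rpow (Cmod (g (- Z.of_nat n - 1)%Z)) p) n).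
  assert (Hgr : Un_growing s).
  { intros n. unfold s. cbn [sum_f_R0].
    pose proof (rpow_nonneg (Cmod (g (Z.of_nat (S n)))) p).
    pose proof (rpow_nonneg (Cmod (g (- Z.of_nat (S n) - 1)%Z)) p). lra. }
  assert (Hs : forall n, s n <= B).
  { intros n. unfold s.
    rewrite (lp_partial_sum (fun x => rpow (Cmod (g x)) p)).
    eapply Rle_trans; [|apply (HB (Z.of_nat n + 1)%Z); lia].
    unfold zsym.
    replace (Z.to_nat (2 * (Z.of_nat n + 1) + 1))
      with (1 + (Z.to_nat (2 * Z.of_nat n + 1) + 1))%nat by lia.
    rewrite !zr_app, !lsum_app.
    replace (- (Z.of_nat n + 1) + Z.of_nat 1)%Z with (- Z.of_nat n)%Z by lia.
    replace (- (Z.of_nat n + 1))%Z with (- Z.of_nat n - 1)%Z by lia.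
    unfold lsum at 2 4. cbn [zr fold_right].
    pose proof (rpow_nonneg (Cmod (g (- Z.of_nat n + Z.of_nat (Z.to_nat (2 * Z.of_nat n + 1)))%Z)) p).
    lra. }
  destruct (growing_cv s Hgr) as [S HS].
  { exists B. intros x [n ->]. apply Hs. }
  exists S. split; [exact HS|]. split.
  - eapply Rle_trans; [|apply (growing_ineq s S Hgr HS O)].
    unfold s. simpl. apply Rplus_le_le_0_compat; apply rpow_nonneg.
  - destruct (Rle_dec S B) as [|L]; auto.
    destruct (HS ((S - B) / 2)) as [n Hn]; [lra|].
    specialize (Hn n (Nat.le_refl n)). specialize (Hs n).
    unfold Rdist, Rabs in Hn. destruct Rcase_abs in Hn; lra.
Qed.

Lemma prodR_zero k g i : (1 <= i <= k)%nat -> g i = 0 -> prodR k g = 0.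
Proof.
  intros Hi E. rewrite <- pr_prodR. apply pr_zero with (i - 1)%nat; [lia|].
  replace (S (i - 1)) with i by lia. auto.
Qed.

Lemma prodC_zero k g i : (1 <= i <= k)%nat -> g i = C0 -> prodC k g = C0.
Proof.
  induction k as [|k IH]; intros Hi E; [lia|]. simpl.
  destruct (Nat.eq_dec i (S k)) as [->|Ne].
  - rewrite E. unfold Cmul, C0; simpl. f_equal; ring.
  - rewrite IH by (auto; lia). unfold Cmul, C0; simpl. f_equal; ring.
Qed.

Lemma Cmod_eq_0 z : Cmod z = 0 -> z = C0.
Proof.
  intros E. pose proof (component_le_Cmod true z) as H1. pose proof (component_le_Cmod false z) as H2.
  rewrite E in H1, H2. simpl in H1, H2. destruct z as [x y]. simpl in *. unfold C0.
  f_equal; [revert H1|revert H2]; unfold Rabs; destruct Rcase_abs; lra.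
Qed.

Lemma exists_zero_dec k (s : nat -> R) :
  (exists i, (1 <= i <= k)%nat /\ s i = 0) \/ (forall i, (1 <= i <= k)%nat -> s i <> 0).
Proof.
  induction k as [|k [[i [Hi E]]|IH]].
  - right; intros; lia.
  - left; exists i; split; auto; lia.
  - destruct (Req_dec (s (S k)) 0) as [E|E].
    + left; exists (S k); split; auto; lia.
    + right. intros i Hi. destruct (Nat.eq_dec i (S k)) as [->|]; auto. apply IH; lia.
Qed.

Theorem theorem2p1 :
  forall (k : nat) (ps : nat -> R) (p : R),
    (1 <= k)%nat ->
    (forall i, (1 <= i <= k)%nat -> 1 < ps i) ->
    1 < p ->
    / p = sumR k (fun i => / ps i) ->
    forall eps : R, 0 < eps ->
    exists K : R,
      forall r Rb : R, 1 <= r -> r <= Rb -> K <= Rb / r ->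
      forall (f : nat -> Z -> Cx) (S : nat -> R),
        (forall i, (1 <= i <= k)%nat -> lp_pow_sum (ps i) (f i) (S i)) ->
        exists SL : R,
          lp_pow_sum p (trunc_op k f r Rb) SL /\
          rpow SL (/ p) <= eps * ln (Rb / r) * prodR k (fun i => rpow (S i) (/ ps i)).
Proof.
  intros k ps p _ Hps Hp Hsum eps He.
  pose proof (pow_lt 2 k ltac:(lra)) as H2k.
  (* [2^k] is the loss from expanding complex products into parts. The 4 recombines the two parts of
     the output: [2^p (B^p + B^p) <= (4 B)^p], since [2 <= 2^p]. *)
  assert (He' : 0 < eps / (4 * 2 ^ k)) by (apply Rdiv_lt_0_compat; lra).
  destruct (component_lp_bound k ps p _ Hps Hp Hsum He') as [K HK].
  exists (Rmax K (exp 1)). intros r Rb Hr HR HKR f S HS.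
  assert (HKR1 : K <= Rb / r) by (eapply Rle_trans; [apply Rmax_l|exact HKR]).
  assert (HKR2 : exp 1 <= Rb / r) by (eapply Rle_trans; [apply Rmax_r|exact HKR]).
  assert (Hip : 0 < / p) by (apply Rinv_0_lt_compat; lra).
  assert (Hpart : forall i, (1 <= i <= k)%nat -> forall H,
            lsum (zsym H) (fun x => rpow (Cmod (f i x)) (ps i)) <= S i)
    by (intros i Hi; apply lp_pow_sum_partial; auto).
  (* A vanishing norm is treated apart, since the component bound takes real powers of the [S i] and
     divides by them. Then some [f i] vanishes identically, and so does the operator. *)
  destruct (exists_zero_dec k S) as [[i [Hi E]]|Hnz].
  - assert (Hfi : forall x, f i x = C0).
    { intros x. apply Cmod_eq_0, (rpow_eq_0 _ (ps i)).
      pose proof (rpow_nonneg (Cmod (f i x)) (ps i)).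
      specialize (Hpart i Hi (Z.abs x)). rewrite E in Hpart.
      pose proof (lsum_ge_term (zsym (Z.abs x)) (fun x => rpow (Cmod (f i x)) (ps i)) x
        ltac:(apply in_zsym; lia) (fun y _ => rpow_nonneg _ _)) as G. cbv beta in G. lra. }
    assert (HT : forall b x, component b (trunc_op k f r Rb x) = 0).
    { intros b x. rewrite component_trunc_op. apply lsum_zero; intros t _.
      rewrite (prodC_zero k _ i) by auto. destruct b; simpl; ring. }
    destruct (lp_pow_sum_exists p (trunc_op k f r Rb) 0) as [SL [HSL HSL0]].
    { intros X _. apply Req_le, lsum_zero; intros x _.
      pose proof (HT true x) as T1. pose proof (HT false x) as T2. simpl in T1, T2.
      unfold Cmod. rewrite T1, T2.
      replace (0 ^ 2 + 0 ^ 2) with 0 by ring. rewrite sqrt_0. apply rpow_0. }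
    exists SL. split; auto. replace SL with 0 by lra.
    rewrite rpow_0, (prodR_zero k _ i Hi) by (rewrite E; apply rpow_0). lra.
  - assert (HSpos : forall i, (1 <= i <= k)%nat -> 0 < S i).
    { intros i Hi. specialize (Hnz i Hi). specialize (Hpart i Hi 0%Z).
      pose proof (lsum_nonneg (zsym 0) (fun x => rpow (Cmod (f i x)) (ps i))
        (fun x _ => rpow_nonneg _ _)). lra. }
    specialize (HK r Rb Hr HR HKR1 HKR2 f S HSpos Hpart).
    rewrite (prodR_ext k (fun i => rpow (S i) (/ ps i)) (fun i => Rpower (S i) (/ ps i)))
      by (intros; apply rpow_Rpower; auto).
    set (P := prodR k (fun i => Rpower (S i) (/ ps i))) in *.
    set (B := 2 ^ k * (eps / (4 * 2 ^ k) * ln (Rb / r) * P)) in *.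
    assert (EB : eps * ln (Rb / r) * P = 4 * B) by (unfold B; field; lra).
    assert (HP : 0 < P).
    { unfold P. clear. induction k as [|k IH]; simpl; [lra|].
      apply Rmult_lt_0_compat; [auto|apply Rpower_pos]. }
    assert (Hl : 1 <= ln (Rb / r)).
    { rewrite <- (ln_exp 1). apply ln_le_compat; [apply exp_pos|auto]. }
    assert (HB : 0 < B).
    { apply Rmult_lt_0_compat; [auto|].
      apply Rmult_lt_0_compat; [apply Rmult_lt_0_compat|]; auto; lra. }
    rewrite EB.
    destruct (lp_pow_sum_exists p (trunc_op k f r Rb) (Rpower (4 * B) p)) as [SL [HSL HSL0]].
    { intros X HX.
      apply Rle_trans with (lsum (zsym X) (fun x => Rpower 2 p
        * (rpow (Rabs (component true (trunc_op k f r Rb x))) p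
           + rpow (Rabs (component false (trunc_op k f r Rb x))) p))).
      - apply lsum_le; intros x. apply rpow_Cmod_le. lra.
      - rewrite lsum_scal, lsum_plus.
        pose proof (HK true X HX) as B1. pose proof (HK false X HX) as B2.
        replace (4 * B) with (2 * (2 * B)) by ring.
        rewrite <- !Rpower_mult_distr by lra.
        apply Rmult_le_compat_l; [apply Rlt_le, Rpower_pos|].
        assert (2 <= Rpower 2 p).
        { rewrite <- (Rpower_1 2) at 1 by lra. apply Rle_Rpower; lra. }
        pose proof (Rpower_pos B p).
        apply Rle_trans with (2 * Rpower B p); [lra|]. apply Rmult_le_compat_r; lra. }
    exists SL. split; auto.
    apply Rle_trans with (rpow (Rpower (4 * B) p) (/ p)).
    + apply rpow_mono; lra.
    + rewrite rpow_Rpower by (apply Rgt_not_eq, Rpower_pos).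
      rewrite Rpower_mult, Rinv_r, Rpower_1 by lra. lra.
Qed.
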